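(* Fix a positive integer $k$ and a nonempty open subset $\Omega\subseteq\mathbb{R}^k$. Let $(\mathbb{R}^n,\cdot)$ be a Carnot group that is purely $k$-unrectifiable. Then there is no injective mapping $f:\Omega\to(\mathbb{R}^n,\cdot)$ that is weakly contact and locally Lipschitz when considered as a map into Euclidean space $\mathbb{R}^n$.
   Context: **Carnot groups.** A Carnot group $G$ is a connected, simply connected, nilpotent Lie group whose Lie algebra has a fixed stratification $\mathfrak g=\mathfrak g_1\oplus\cdots\oplus\mathfrak g_r$, with $\mathfrak g_{j+1}=[\mathfrak g_1,\mathfrak g_j]$ for $1\le j\le r-1$ and $[\mathfrak g,\mathfrak g_r]=0$; $r$ is its step, $\mathfrak g_1$ its horizontal layer, $m_j=\dim\mathfrak g_j$. A basis $\{X^1,\ldots,X^n\}$ of $\mathfrak g$ is compatible with the stratification if $X^{h_{j-1}+1},\ldots,X^{h_j}$ is a basis of $\mathfrak g_j$ for each $j$, where $h_j=\sum_{i\le j}m_i$. **Coordinates.** $(\mathbb{R}^n,\cdot)$ denotes a Carnot group $G$ identified with $\mathbb{R}^n$ through a compatible basis in one of two ways. First kind: identify $\mathfrak g$ with $\mathbb{R}^n$ by the basis and use the group law $X\star Y=\exp^{-1}(\exp(X)\exp(Y))$. Second kind: use the group law $X\odot Y=\Phi^{-1}(\Phi(X)\Phi(Y))$, where $\Phi(a_1X^1+\cdots+a_nX^n)=\exp(a_1X^1)\cdots\exp(a_nX^n)$ (a diffeomorphism $\mathfrak g\to G$). $\mathbb{R}^n$ alone denotes Euclidean space. **Carnot–Carathéodory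 metric.** Let $X^1,\ldots,X^{m_1}$ also denote the left-invariant vector fields on $(\mathbb{R}^n,\cdot)$ that agree at $0$ with the first $m_1$ coordinate vectors. The horizontal space at $p$ is $H_p(\mathbb{R}^n,\cdot)=\mathrm{span}\{X^1_p,\ldots,X^{m_1}_p\}$, with inner product making these vectors orthonormal. A path $\gamma:[a,b]\to\mathbb{R}^n$ is horizontal if it is absolutely continuous (Euclidean sense) and $\gamma'(t)\in H_{\gamma(t)}(\mathbb{R}^n,\cdot)$ for a.e. $t$; its length is $\int_a^b|\gamma'(t)|\,dt$ with respect to this inner product. $d_{cc}(p,q)$ is the infimum of lengths of horizontal paths from $p$ to $q$. $(\mathbb{R}^n,\cdot)$ is always equipped with $d_{cc}$. **Pure unrectifiability.** $(\mathbb{R}^n,\cdot)$ is purely $k$-unrectifiable if for every $A\subseteq\mathbb{R}^k$ and every Lipschitz map $f:A\to(\mathbb{R}^n,\cdot)$ one has $\mathcal H^k_{cc}(f(A))=0$, where $\mathcal H^k_{cc}$ is the $k$-dimensional Hausdorff measure of $d_{cc}$. **Weakly contact.** A locally Lipschitz map $f:\Omega\to\mathbb{R}^n$ (Euclidean target) is weakly contact if $\mathrm{im}\,df_x\subset H_{f(x)}(\mathbb{R}^n,\cdot)$ for $\mathcal H^k$-almost every $x\in\Omega$, where $df_x$ is the total derivative (which exists for almost every $x$ by Rademacher's theorem). *)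

(* Defs.v *)
From HB Require Import structures.
From mathcomp Require Import all_boot all_order all_algebra.
From mathcomp Require Import all_classical all_reals all_analysis.

Set Implicit Arguments.
Unset Strict Implicit.
Unset Printing Implicit Defensive.

Import Order.TTheory GRing.Theory Num.Theory.
Import numFieldNormedType.Exports.

Local Open Scope classical_set_scope.
Local Open Scope ring_scope.

(** ** Metric notions

    The library norm on ['rV[R]_n] is the sup norm: it is used for the topology
    and for derivatives only.  Distances are extended-real valued, so that the
    Carnot-Caratheodory distance can be defined as an infimum before it is known
    to be finite. *)

Definition enorm (R : realType) (n : nat) (x : 'rV[R]_n) : R :=
  Num.sqrt (\sum_(i < n) x 0 i ^+ 2).

Definition euclid_dist (R : realType) (n : nat) (x y : 'rV[R]_n) : \bar R :=
  (enorm (x - y))%:E.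

Definition lipschitz_for (R : realType) (T U : Type)
    (dT : T -> T -> \bar R) (dU : U -> U -> \bar R) (A : set T) (f : T -> U) :=
  exists2 L : R, 0 <= L &
    forall x y, A x -> A y -> (dU (f x) (f y) <= L%:E * dT x y)%E.

Definition locally_lipschitz (R : realType) (k n : nat) (Omega : set 'rV[R]_k)
    (f : 'rV[R]_k -> 'rV[R]_n) :=
  forall x, Omega x ->
    exists2 U, nbhs x U & lipschitz_for (@euclid_dist R k) (@euclid_dist R n) (Omega `&` U) f.

(** The point [0] is added so that the diameter of the empty set is [0]. *)
Definition ediam (R : realType) (T : Type) (d : T -> T -> \bar R) (E : set T) :
    \bar R :=
  ereal_sup ([set 0%E] `|` [set d x y | x in E & y in E]).

Definition hausdorff_content (R : realType) (T : Type) (d : T -> T -> \bar R)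
    (k : nat) (delta : R) (A : set T) : \bar R :=
  ereal_inf [set (\sum_(0 <= i <oo) (ediam d (E i)) ^+ k)%E | E in
    [set E : nat -> set T |
      A `<=` \bigcup_i E i /\ forall i, (ediam d (E i) <= delta%:E)%E]].

(** [k]-dimensional Hausdorff measure, for [0 < k], without the normalising
    constant: it is only used through its null sets. *)
Definition hausdorff_measure (R : realType) (T : Type) (d : T -> T -> \bar R)
    (k : nat) (A : set T) : \bar R :=
  ereal_sup [set hausdorff_content d k delta A | delta in [set e : R | 0 < e]].

(** ** Lie group laws on [R^n] *)

(** Class C^infinity: all iterated directional derivatives exist and are
    continuous. *)
Fixpoint iter_derive (R : realType) (V W : normedModType R) (vs : seq V)
    (f : V -> W) : V -> W :=
  if vs is v :: vs' then 'D_v (iter_derive vs' f) else f.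

Definition smooth (R : realType) (V W : normedModType R) (f : V -> W) :=
  forall vs : seq V, continuous (iter_derive vs f) /\
    forall x v, derivable (iter_derive vs f) x v.

Definition lie_group_law (R : realType) (n : nat)
    (mul : 'rV[R]_n -> 'rV[R]_n -> 'rV[R]_n) (inv : 'rV[R]_n -> 'rV[R]_n) :=
  [/\ associative mul, left_id 0 mul & right_id 0 mul] /\
  [/\ left_inverse 0 inv mul, right_inverse 0 inv mul,
      smooth (fun pq : 'rV[R]_n * 'rV[R]_n => mul pq.1 pq.2) & smooth inv].

(** The left-invariant vector field with value [v] at the identity [0]. *)
Definition left_field (R : realType) (n : nat)
    (mul : 'rV[R]_n -> 'rV[R]_n -> 'rV[R]_n) (v p : 'rV[R]_n) : 'rV[R]_n :=
  'd (mul p) 0 v.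

Definition field_bracket (R : realType) (n : nat) (V W : 'rV[R]_n -> 'rV[R]_n)
    (p : 'rV[R]_n) : 'rV[R]_n :=
  'D_(V p) W p - 'D_(W p) V p.

(** The Lie algebra is the tangent space [R^n] at [0], and [x] in it stands for
    [left_field mul x]. *)
Definition lie_bracket (R : realType) (n : nat)
    (mul : 'rV[R]_n -> 'rV[R]_n -> 'rV[R]_n) (x y : 'rV[R]_n) : 'rV[R]_n :=
  field_bracket (left_field mul x) (left_field mul y) 0.

Definition one_parameter_subgroup (R : realType) (n : nat)
    (mul : 'rV[R]_n -> 'rV[R]_n -> 'rV[R]_n) (x : 'rV[R]_n) (g : R -> 'rV[R]_n) :=
  (forall s t, g (s + t) = mul (g s) (g t)) /\ is_derive (0 : R) (1 : R) g x.

Definition is_lie_exp (R : realType) (n : nat)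
    (mul : 'rV[R]_n -> 'rV[R]_n -> 'rV[R]_n) (E : 'rV[R]_n -> 'rV[R]_n) :=
  forall x, one_parameter_subgroup mul x (fun t => E (t *: x)).

(** ** Stratifications and exponential coordinates *)

(** The standard basis indexed by [nat]; [basis_vec R n j] is [0] for [n <= j].
    Indices start at [0]: the vector [X^(j+1)] of the basis is [basis_vec R n j]. *)
Definition basis_vec (R : realType) (n j : nat) : 'rV[R]_n :=
  \row_(i < n) (i == j :> nat)%:R.

Definition lin_span (R : realType) (n : nat) (S : set 'rV[R]_n) :
    set 'rV[R]_n :=
  [set v | exists (N : nat) (c : 'I_N -> R) (s : 'I_N -> 'rV[R]_n),
     (forall i, S (s i)) /\ v = \sum_(i < N) c i *: s i].

(** [h_j = m_1 + ... + m_j]. *)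
Definition cumdim (m : nat -> nat) (j : nat) : nat := (\sum_(1 <= i < j.+1) m i)%N.

(** For [1 <= j]: the span of [X^(h_(j-1)+1), ..., X^(h_j)]. *)
Definition layer (R : realType) (n : nat) (m : nat -> nat) (j : nat) :
    set 'rV[R]_n :=
  lin_span [set basis_vec R n i | i in
    [set i : nat | (cumdim m j.-1 <= i < cumdim m j)%N]].

(** The standard basis is compatible with a stratification of step [r] whose
    layers have dimensions [m 1, ..., m r].  The trivial group, [n = 0], is
    given [r = 1] and [m 1 = 0]. *)
Definition stratified (R : realType) (n : nat)
    (mul : 'rV[R]_n -> 'rV[R]_n -> 'rV[R]_n) (r : nat) (m : nat -> nat) :=
  [/\ (0 < r)%N, n = cumdim m r, forall j, (1 < j <= r)%N -> (0 < m j)%N,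
      forall j, (1 <= j < r)%N ->
        @layer R n m j.+1 =
        lin_span [set lie_bracket mul x y | x in @layer R n m 1 & y in @layer R n m j]
    & forall x y, @layer R n m r y -> lie_bracket mul x y = 0].

(** [(R^n, .)] is identified with the Lie group it carries through
    [exp : g -> G] (first kind) or through
    [Phi (a_1 X^1 + ... + a_n X^n) = exp (a_1 X^1) ... exp (a_n X^n)]
    (second kind); in these coordinates the map in question is the identity. *)
Definition first_kind (R : realType) (n : nat) (E : 'rV[R]_n -> 'rV[R]_n) :=
  forall a : 'rV[R]_n, E (\sum_(i < n) a 0 i *: basis_vec R n i) = a.

Definition second_kind (R : realType) (n : nat)
    (mul : 'rV[R]_n -> 'rV[R]_n -> 'rV[R]_n) (E : 'rV[R]_n -> 'rV[R]_n) :=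
  forall a : 'rV[R]_n, \big[mul/0]_(i < n) E (a 0 i *: basis_vec R n i) = a.

(** A Carnot group in exponential coordinates.  Connectedness and simple
    connectedness hold since the manifold is [R^n], and nilpotency follows from
    the stratification. *)
Record carnot_group (R : realType) (n : nat) := CarnotGroup {
  cg_mul : 'rV[R]_n -> 'rV[R]_n -> 'rV[R]_n;
  cg_inv : 'rV[R]_n -> 'rV[R]_n;
  cg_exp : 'rV[R]_n -> 'rV[R]_n;
  cg_step : nat;
  cg_dim : nat -> nat;
  cg_lie : lie_group_law cg_mul cg_inv;
  cg_expP : is_lie_exp cg_mul cg_exp;
  cg_strat : stratified cg_mul cg_step cg_dim;
  cg_coord : first_kind cg_exp \/ second_kind cg_mul cg_exp }.

(** ** The Carnot-Caratheodory metric *)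

Definition hor_comb (R : realType) (n : nat) (G : carnot_group R n)
    (p : 'rV[R]_n) (u : 'rV[R]_(cg_dim G 1)) : 'rV[R]_n :=
  \sum_(j < cg_dim G 1) u 0 j *: left_field (cg_mul G) (basis_vec R n j) p.
Arguments hor_comb {R n} G p u.

Definition horizontal_space (R : realType) (n : nat) (G : carnot_group R n)
    (p : 'rV[R]_n) : set 'rV[R]_n := range (hor_comb G p).

(** The coordinates in the frame [X^1_p, ..., X^(m_1)_p]; only meaningful for
    [v] in [horizontal_space G p]. *)
Definition hor_coord (R : realType) (n : nat) (G : carnot_group R n)
    (p v : 'rV[R]_n) : 'rV[R]_(cg_dim G 1) :=
  xget 0 [set u | hor_comb G p u = v].

(** The norm of the inner product for which that frame is orthonormal. *)
Definition hor_norm (R : realType) (n : nat) (G : carnot_group R n)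
    (p v : 'rV[R]_n) : R := enorm (hor_coord G p v).

Definition abs_continuous (R : realType) (n : nat) (a b : R)
    (g : R -> 'rV[R]_n) :=
  forall e : R, 0 < e -> exists2 d : R, 0 < d &
    forall (N : nat) (s t : 'I_N -> R),
      (forall i, [/\ a <= s i, s i <= t i & t i <= b]) ->
      (forall i j, i != j -> t i <= s j \/ t j <= s i) ->
      \sum_(i < N) (t i - s i) < d ->
      \sum_(i < N) enorm (g (t i) - g (s i)) < e.

Definition horizontal_path (R : realType) (n : nat) (G : carnot_group R n)
    (a b : R) (g : R -> 'rV[R]_n) :=
  abs_continuous a b g /\
  {ae @lebesgue_measure R, forall t : R, a <= t <= b ->
     derivable g t 1 /\ horizontal_space G (g t) (derive1 g t)}.

Definition path_length (R : realType) (n : nat) (G : carnot_group R n)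
    (a b : R) (g : R -> 'rV[R]_n) : \bar R :=
  (\int[@lebesgue_measure R]_(t in `[a, b]) (hor_norm G (g t) (derive1 g t))%:E)%E.

Definition dcc (R : realType) (n : nat) (G : carnot_group R n)
    (p q : 'rV[R]_n) : \bar R :=
  ereal_inf [set l | exists (a b : R) (g : R -> 'rV[R]_n),
    [/\ a <= b, horizontal_path G a b g, g a = p, g b = q
      & l = path_length G a b g]].

(** ** Pure unrectifiability and weakly contact maps *)

Definition purely_unrectifiable (R : realType) (n : nat) (G : carnot_group R n)
    (k : nat) :=
  forall (A : set 'rV[R]_k) (f : 'rV[R]_k -> 'rV[R]_n),
    lipschitz_for (@euclid_dist R k) (dcc G) A f ->
    hausdorff_measure (dcc G) k (f @` A) = 0%E.

(** Maps on [Omega] are total functions of which only the values on [Omega]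
    matter; as [Omega] is open, ['d f x] depends on these values only. *)
Definition weakly_contact (R : realType) (k n : nat) (G : carnot_group R n)
    (Omega : set 'rV[R]_k) (f : 'rV[R]_k -> 'rV[R]_n) :=
  hausdorff_measure (@euclid_dist R k) k
    [set x | Omega x /\
       ~ (differentiable f x /\ range ('d f x) `<=` horizontal_space G (f x))] = 0%E.

(* Main.v *)
Require Import Defs.
From mathcomp Require Import all_boot all_order all_algebra all_fingroup.
From mathcomp Require Import all_classical all_reals all_analysis.
From mathcomp Require Import measurable_realfun.
From mathcomp Require Import zify ring lra.
Import Order.TTheory GRing.Theory Num.Theory.
Import numFieldNormedType.Exports.

Set Implicit Arguments.
Unset Strict Implicit.

Local Open Scope classical_set_scope.
Local Open Scope ring_scope.

(** Suppose that such a map f exists, and let Q be a small closed cube around a point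
    of Omega. The image f(Q) is null for the Carnot-Caratheodory distance, hence also
    for the Euclidean one, and this contradicts injectivity.

    The map f is Lipschitz from Q to the Carnot-Caratheodory distance
    ([dcc_lipschitz]). Let N be the null set of points where f is not
    differentiable or its differential is not horizontal. The segment from x to x'
    may lie inside N, but there is a broken line from x to x', of length comparable
    to |x - x'|, that meets N only at a null set of times ([generic_broken_line]).
    Off these times the image path has a horizontal velocity whose Euclidean norm is
    controlled by the Lipschitz constant of f; its horizontal norm is controlled as
    well because the left-invariant frame is uniformly independent on bounded sets
    ([hor_comb_bounded_below]). Pure unrectifiability, applied to the restriction of
    f to Q, then makes f(Q) null for the k-dimensional Hausdorff measure of the
    Carnot-Caratheodory distance.

    That distance dominates the Euclidean one locally ([dcc_locally_dominates]),
    since a path is at least as long as its displacement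
    ([abs_continuous_integral_bound]) and the frame is bounded on bounded sets. Thus
    f(Q) is also null for the k-dimensional Euclidean Hausdorff measure.

    But an injective Lipschitz image of a k-dimensional cube is never null
    ([injective_lipschitz_image_not_null]). By injectivity the images of two opposite
    faces of Q are disjoint compact sets, so the difference of the distances to them
    is a Lipschitz function on R^n which is negative on one and positive on the
    other. The k pairs of faces give a Lipschitz map u from R^n to R^k. The compact
    set u(f(Q)) is null in R^k, so it misses points c arbitrarily close to 0, and
    then every coordinate of u o f - c changes sign between opposite faces of Q. By
    the Poincare-Miranda theorem, which rests on a Sperner type count in a
    triangulated grid ([kuhn_cube]), c belongs to u(f(Q)).

    All null sets of R^k are handled through countable covers with a small sum of
    k-th powers of the diameters ([null_cover]). The one consequence of Fubini's
    theorem that is used, a null set meets some line of each coordinate direction in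
    a null set ([null_slice]), follows from one-dimensional integration by choosing
    the coordinates of the line one after the other ([averaging]). *)

(** * Norms of row vectors *)

Lemma coord_le_norm (R : realType) n (x : 'rV[R]_n) j : `|x 0 j| <= `|x|.
Proof.
rewrite [leRHS]mx_normrE.
exact: (le_bigmax _ (fun i : 'I_1 * 'I_n => `|x i.1 i.2|) (0, j)).
Qed.

Lemma norm_le_coord (R : realType) n (x : 'rV[R]_n) c : 0 <= c ->
  (forall j, `|x 0 j| <= c) -> `|x| <= c.
Proof.
move=> c0 xc; rewrite [leLHS]mx_normrE; apply/bigmax_leP; split => // -[i j] _ /=.
by rewrite ord1.
Qed.

Lemma norm_le_enorm (R : realType) n (x : 'rV[R]_n) : `|x| <= enorm x.
Proof.
apply: norm_le_coord => [|j]; first exact: sqrtr_ge0.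
rewrite /enorm -sqrtr_sqr ler_wsqrtr // (bigD1 j) //= lerDl.
by apply: sumr_ge0 => i _; exact: sqr_ge0.
Qed.

Lemma enorm_le_norm (R : realType) n (x : 'rV[R]_n) : enorm x <= n%:R * `|x|.
Proof.
have nx : 0 <= n%:R * `|x| by rewrite mulr_ge0.
rewrite -(ger0_norm nx) -sqrtr_sqr ler_wsqrtr // exprMn.
apply: (@le_trans _ _ (\sum_(i < n) `|x| ^+ 2)).
  apply: ler_sum => i _; rewrite -real_normK ?num_real //.
  by rewrite lerXn2r ?nnegrE // coord_le_norm.
rewrite sumr_const card_ord -[leLHS]mulr_natl ler_wpM2r ?sqr_ge0 // -natrX ler_nat.
by case: n {x nx} => // n; rewrite leq_pmulr.
Qed.

(** * Sperner-Kuhn lemma on a cubical grid *)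

Section KuhnGrid.
Variables (k N : nat).
Implicit Types (v : {ffun 'I_k -> 'I_N.+1}) (s : 'S_k) (b : 'I_k -> ('I_k -> nat) -> 'F_2).

Lemma addF2 (x : 'F_2) : x + x = 0.
Proof. by rewrite -mulr2n; apply/val_inj; rewrite /=; case: x => [[|[|]]]. Qed.

Lemma F2_eq (x y : 'F_2) : x + y = 0 -> x = y.
Proof. by move=> h; rewrite -[x]addr0 -(addF2 y) addrA h add0r. Qed.

(** The vertices of a simplex of the Freudenthal triangulation of the grid: from the
    base [v] the coordinates are raised one at a time, coordinate [i] at step
    [s i + 1]. *)
Definition vertex v s (j : nat) : 'I_k -> nat := fun i => (v i + (s i < j))%N.

(** The permutations pair off through the transposition, and two equal terms cancel
    modulo 2. *)
Lemma sum_perm_swap (Phi : 'S_k -> 'F_2) (i j : 'I_k) : i != j ->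
  (forall s, Phi (s * tperm i j)%g = Phi s) -> \sum_s Phi s = 0.
Proof.
move=> ij Phis; rewrite (bigID (fun s : 'S_k => odd_perm s)) /=.
have inj : injective (fun s : 'S_k => (s * tperm i j)%g) by exact: mulIg.
rewrite (reindex_inj inj) /=.
have E : \sum_(s : 'S_k | odd_perm (s * tperm i j)%g) Phi (s * tperm i j)%g =
    \sum_(s : 'S_k | ~~ odd_perm s) Phi s.
  by apply: eq_big => s; rewrite ?odd_permM ?odd_tperm ?ij ?addbT.
by rewrite E addF2.
Qed.

(** Exchanging two consecutive steps replaces only the vertex between them: the two
    simplices share an interior face. *)
Lemma vertex_swap v s (m : nat) (i j : 'I_k) l : i = m :> nat -> j = m.+1 :> nat ->
  l != m.+1 -> vertex v (s * tperm i j)%g l = vertex v s l.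
Proof.
move=> im jm lm; apply: funext => a; rewrite /vertex permM; congr (_ + nat_of_bool _)%N.
case: tpermP => [->|->|//]; rewrite im jm; case: ltngtP lm => //; lia.
Qed.

(** Labels are 0-cochains modulo 2. This is the value on the face [w 0, ..., w (k - 1)]
    of the cup product of the coboundaries of all [b j] with [j != i], in their order,
    with [b i] itself as the factor at place [i]. *)
Definition face_cochain (i : 'I_k) b (w : nat -> 'I_k -> nat) : 'F_2 :=
  \prod_(j < k) (if j == i then b i (w i)
                 else if (j < i)%N then b j (w j.+1) - b j (w j)
                 else b j (w j) - b j (w j.-1)).

(** Intermediate stage between the [face_cochain] of the face without first vertex,
    [m = 0], and a product of increments over consecutive edges, [m = i]. *)
Definition front_stage (i : 'I_k) b (m : nat) v s : 'F_2 :=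
  \prod_(j < k) (if j == i then b i (vertex v s i.+1)
                 else if (m <= j < i)%N then b j (vertex v s j.+2) - b j (vertex v s j.+1)
                 else b j (vertex v s j.+1) - b j (vertex v s j)).

(** The same for the face without last vertex: the [face_cochain] is reached at
    [m = k - 1] and the product of increments at [m = i]. *)
Definition back_stage (i : 'I_k) b (m : nat) v s : 'F_2 :=
  \prod_(j < k) (if j == i then b i (vertex v s i)
                 else if (i < j <= m)%N then b j (vertex v s j) - b j (vertex v s j.-1)
                 else b j (vertex v s j.+1) - b j (vertex v s j)).

Lemma prodD1 (m : 'I_k) (E F G : 'I_k -> 'F_2) :
  (forall j, j != m -> E j = F j) -> (forall j, j != m -> E j = G j) ->
  \prod_j F j + \prod_j G j = (F m + G m) * \prod_(j | j != m) E j.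
Proof.
move=> EF EG; rewrite (bigD1 m) //= [X in _ + X](bigD1 m) //= mulrDl.
by rewrite -(eq_bigr _ EF) -(eq_bigr _ EG).
Qed.

(** The two stages differ in the factor [m] only. Adding these two factors merges the
    edges at vertex [m + 1] into one, so that the sum of the stages does not see this
    vertex and cancels between the two simplices that differ there. *)
Lemma front_stage_step (i : 'I_k) b m v : (m < i)%N ->
  \sum_s front_stage i b m.+1 v s = \sum_s front_stage i b m v s.
Proof.
move=> mi; apply: F2_eq; rewrite -big_split /=.
have mk : (m < k)%N by rewrite (ltn_trans mi).
have mk1 : (m.+1 < k)%N by rewrite (leq_ltn_trans mi).
pose E s (j : 'I_k) := if j == i then b i (vertex v s i.+1)
                 else if (m <= j < i)%N then b j (vertex v s j.+2) - b j (vertex v s j.+1)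
                 else b j (vertex v s j.+1) - b j (vertex v s j).
pose Phi s := (b (Ordinal mk) (vertex v s m.+2) - b (Ordinal mk) (vertex v s m)) *
  \prod_(j | j != Ordinal mk) E s j.
rewrite (eq_bigr Phi); last first.
  move=> s _; rewrite /front_stage (@prodD1 (Ordinal mk) (E s)) //=.
    rewrite /Phi; congr (_ * _).
    rewrite -val_eqE /= (ltn_eqF mi) leqnn mi ltnn /=.
    by rewrite addrC addrA subrK.
  move=> j jm; rewrite /E; case: ifP => // ji.
  have -> : (m <= j)%N = (m < j)%N; last by [].
  by rewrite [RHS]ltn_neqAle eq_sym; move: jm; rewrite -val_eqE /= => ->.
apply: (@sum_perm_swap _ (Ordinal mk) (Ordinal mk1)) => [|s].
  by rewrite -val_eqE /= ltn_eqF.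
have vs l : l != m.+1 -> vertex v (s * tperm (Ordinal mk) (Ordinal mk1))%g l = vertex v s l.
  by move=> lm; apply: (@vertex_swap _ _ m).
rewrite /Phi (vs m.+2) ?(vs m); [|lia..]; congr (_ * _).
apply: eq_bigr => j; rewrite -val_eqE /= => jm; rewrite /E -val_eqE.
case: ifP => [/eqP ji|ji]; last case: ifP => mj; rewrite ?vs //=; move: jm ji => /=; lia.
Qed.

Lemma back_stage_step (i : 'I_k) b m v : (i <= m)%N -> (m.+1 < k)%N ->
  \sum_s back_stage i b m.+1 v s = \sum_s back_stage i b m v s.
Proof.
move=> im mk1; apply: F2_eq; rewrite -big_split /=.
have mk : (m < k)%N by rewrite (ltn_trans _ mk1).
pose E s (j : 'I_k) := if j == i then b i (vertex v s i)
                 else if (i < j <= m)%N then b j (vertex v s j) - b j (vertex v s j.-1)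
                 else b j (vertex v s j.+1) - b j (vertex v s j).
pose Phi s := (b (Ordinal mk1) (vertex v s m.+2) - b (Ordinal mk1) (vertex v s m)) *
  \prod_(j | j != Ordinal mk1) E s j.
rewrite (eq_bigr Phi); last first.
  move=> s _; rewrite /back_stage (@prodD1 (Ordinal mk1) (E s)) //=.
    rewrite /Phi; congr (_ * _).
    rewrite -val_eqE /= (@gtn_eqF i m.+1) // ltnS im leqnn ltnn /=.
    by rewrite addrC addrA subrK.
  move=> j jm; rewrite /E; case: ifP => // ji.
  have -> : (j <= m)%N = (j <= m.+1)%N; last by [].
  by move: jm; rewrite -val_eqE /=; lia.
apply: (@sum_perm_swap _ (Ordinal mk) (Ordinal mk1)) => [|s].
  by rewrite -val_eqE /= ltn_eqF.
have vs l : l != m.+1 -> vertex v (s * tperm (Ordinal mk) (Ordinal mk1))%g l = vertex v s l.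
  by move=> lm; apply: (@vertex_swap _ _ m).
rewrite /Phi (vs m.+2) ?(vs m); [|lia..]; congr (_ * _).
apply: eq_bigr => j; rewrite -val_eqE /= => jm; rewrite /E -val_eqE.
case: ifP => [/eqP ji|ji]; last case: ifP => mj; rewrite ?vs //=; move: jm ji => /=; lia.
Qed.

(** Leibniz rule: the coboundary of [face_cochain i] is the cup product of the
    coboundaries of all labels. In the sum over the simplices with base [v] the faces
    opposite to an inner vertex are shared by two simplices and cancel, and the faces
    opposite to the first and to the last vertex remain. *)
Lemma coboundary_sum (i : 'I_k) b v :
  \sum_(s : 'S_k) \prod_(j < k) (b j (vertex v s j.+1) - b j (vertex v s j)) =
  \sum_s face_cochain i b (fun j => vertex v s j.+1) +
  \sum_s face_cochain i b (vertex v s).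
Proof.
have up m : (m <= i)%N -> \sum_s front_stage i b m v s = \sum_s front_stage i b 0 v s.
  by elim: m => // m IH mi; rewrite front_stage_step // IH // ltnW.
have low m : (i <= m < k)%N -> \sum_s back_stage i b m v s = \sum_s back_stage i b i v s.
  elim: m => [|m IH] /andP[im mk].
    by have -> : i = 0%N :> nat by lia.
  by case: (ltngtP i m.+1) im => // [im|->//] _; rewrite back_stage_step ?IH //; lia.
have -> : \sum_s face_cochain i b (vertex v s) = \sum_s back_stage i b i v s.
  rewrite -(low k.-1); last by have := ltn_ord i; lia.
  apply: eq_bigr => s _; apply: eq_bigr => j _; case: ifP => // ji.
  have := ltn_ord j; move: ji; rewrite -val_eqE /= => ji jk.
  case: (ltnP j i) => ij; first by rewrite ltnNge ltnW.
  by have -> : (i < j <= k.-1)%N by lia.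
have -> : \sum_s face_cochain i b (fun j => vertex v s j.+1) = \sum_s front_stage i b i v s.
  rewrite up //; apply: eq_bigr => s _; apply: eq_bigr => j _; case: ifP => // ji.
  case: (ltnP j i) => //= ij; rewrite prednK //.
  by move: ji; rewrite -val_eqE /=; lia.
rewrite -big_split /=; apply: eq_bigr => s _.
pose E (j : 'I_k) := b j (vertex v s j.+1) - b j (vertex v s j).
rewrite /front_stage /back_stage (@prodD1 i E) ?eqxx; last 2 first.
- by move=> j ji; rewrite (negbTE ji); case: ifP => //; lia.
- by move=> j ji; rewrite (negbTE ji); case: ifP => //; lia.
rewrite (bigD1 i) //=; congr (_ * _); congr (_ + _).
by apply/esym/F2_eq; rewrite subrr.
Qed.

(** On a boundary face of the cube that is orthogonal to direction [i0], the label [i0]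
    is constant, so its coboundary vanishes, or, for [i0 = i], it is itself zero. *)
Lemma face_cochain_eq0 (i i0 : 'I_k) b w :
  (forall x y, i0 != i -> x i0 = w 0%N i0 -> y i0 = w 0%N i0 -> b i0 x = b i0 y) ->
  (forall x, i0 = i -> x i0 = w 0%N i0 -> b i0 x = 0) ->
  (forall j, (j < k)%N -> w j i0 = w 0%N i0) -> face_cochain i b w = 0.
Proof.
move=> bconst b0 wconst; rewrite /face_cochain (bigD1 i0) //=.
case: eqVneq => [ii0|ii0]; first by rewrite -ii0 b0 ?mul0r // wconst.
have ? := ltn_ord i; have ? := ltn_ord i0; move: (ii0); rewrite -val_eqE /= => ?.
by case: ifP => ?; rewrite (_ : _ - _ = 0) ?mul0r //; apply/eqP; rewrite subr_eq0; apply/eqP;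
  apply: bconst => //; apply: wconst; lia.
Qed.

(** The face of a simplex without first vertex is the face without last vertex of the
    simplex obtained by moving the first step to the end. The base then moves along
    that step; it is taken cyclically, to have a bijection of the grid. *)
Definition rotate_perm : 'S_k := perm (@ord_pred_inj k).

Definition rotate_base s v : {ffun 'I_k -> 'I_N.+1} :=
  [ffun i => if (s i == 0 :> nat)%N then ordS (v i) else v i].

Lemma rotate_base_inj s : injective (rotate_base s).
Proof.
move=> v v' /ffunP e; apply/ffunP => i; have := e i.
by rewrite !ffunE; case: ifP => // _ /ordS_inj.
Qed.

Lemma vertex_rotate v s (i0 : 'I_k) j : s i0 = 0%N :> nat -> (v i0 < N)%N -> (j < k)%N ->
  vertex (rotate_base s v) (s * rotate_perm)%g j = vertex v s j.+1.
Proof.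
move=> s0 vN jk; apply: funext => i; rewrite /vertex ffunE permM permE /=.
have [si|si] := eqVneq (s i : nat) 0%N; last first.
  have -> : ((s i + k).-1 %% k = (s i).-1)%N.
    have -> : ((s i + k).-1 = (s i).-1 + k)%N by have := ltn_ord (s i); lia.
    by rewrite modnDr modn_small //; have := ltn_ord (s i); lia.
  by congr (_ + nat_of_bool _)%N; lia.
have -> : i = i0 by apply: (@perm_inj _ s); apply/val_inj; rewrite /= si s0.
rewrite s0 /= add0n modn_small ?ltnS ?modn_small; [|lia..].
have -> : (k.-1 < j)%N = false by lia.
by rewrite addn0 addn1.
Qed.

(** Stokes formula modulo 2: the remaining faces cancel between simplices of adjacent
    cubes ([vertex_rotate]), and those in the boundary of the grid contribute
    nothing. *)
Lemma coboundary_sum_eq0 (i : 'I_k) b :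
  (forall (j : 'I_k) x y, j != i -> x j = y j -> x j = 0%N \/ x j = N.+1 -> b j x = b j y) ->
  (forall x, x i = 0%N \/ x i = N.+1 -> b i x = 0) ->
  \sum_v \sum_(s : 'S_k) \prod_(j < k) (b j (vertex v s j.+1) - b j (vertex v s j)) = 0.
Proof.
move=> bconst b0.
rewrite (eq_bigr _ (fun v _ => coboundary_sum i b v)) big_split /=.
rewrite exchange_big [X in _ + X]exchange_big /=.
have inj : injective (fun s : 'S_k => (s * rotate_perm)%g) by exact: mulIg.
rewrite [X in _ + X](reindex_inj inj) /= -big_split /=; apply: big1 => s _.
rewrite [X in _ + X](reindex_inj (@rotate_base_inj s)) /= -big_split /=.
apply: big1 => v _.
pose i0 := (s^-1)%g (Ordinal (leq_ltn_trans (leq0n i) (ltn_ord i))).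
have s0 : s i0 = 0%N :> nat by rewrite /i0 permKV.
have zero w : (w 0%N i0 = 0%N \/ w 0%N i0 = N.+1) ->
    (forall j, (j < k)%N -> w j i0 = w 0%N i0) -> face_cochain i b w = 0.
  move=> w01 wc; apply: (@face_cochain_eq0 i i0) => // [x y ne xw yw|x e xw].
    by apply: bconst; rewrite ?xw ?yw.
  by rewrite e; apply: b0; rewrite -e xw.
have [vN|vN] := ltnP (v i0) N.
  rewrite -[X in _ + X = _](_ : face_cochain i b (fun j => vertex v s j.+1) = _) ?addF2 //.
  apply: eq_bigr => j _; have ? := ltn_ord j; have ? := ltn_ord i.
  case: eqVneq => [//|ne]; first by rewrite (@vertex_rotate _ _ i0 _ s0).
  move: ne; rewrite -val_eqE /= => ne.
  by case: ifP => ?; rewrite !(@vertex_rotate _ _ i0 _ s0) // ?prednK //; lia.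
have vN' : v i0 = N :> nat by apply/eqP; rewrite eqn_leq vN -ltnS ltn_ord.
rewrite !zero ?addr0 //.
- by left; rewrite /vertex ffunE s0 eqxx /= vN' modnn.
- move=> j jk; rewrite /vertex permM permE /= s0 add0n modn_small; last by lia.
  have -> : (k.-1 < j)%N = false by lia.
  by [].
- by right; rewrite /vertex vN' s0 addn1.
- by move=> j jk; rewrite /vertex s0.
Qed.

(** The product of the increments of the labels, summed over all simplices modulo 2,
    does not change when one label [l i] is replaced by the standard one, [0 < x i]:
    both agree on the two faces orthogonal to direction [i], so that the difference
    vanishes there and the Stokes formula applies. For the standard labels only the
    simplex with base 0 and identity permutation contributes, and the sum is 1. *)
Lemma kuhn_cube (l : 'I_k -> ('I_k -> nat) -> bool) :
  (forall i x, x i = 0%N -> l i x = false) ->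
  (forall i x, x i = N.+1 -> l i x = true) ->
  exists v s, forall j : 'I_k, l j (vertex v s j.+1) != l j (vertex v s j).
Proof.
move=> l0 l1.
pose std (j : 'I_k) (x : 'I_k -> nat) : 'F_2 := (0 < x j)%N%:R.
pose lab (j : 'I_k) (x : 'I_k -> nat) : 'F_2 := (l j x)%:R.
(* the first [t] labels are the given ones, the others are standard *)
pose hyb (t : nat) (j : 'I_k) x := if (j < t)%N then lab j x else std j x.
pose total b := \sum_v \sum_(s : 'S_k)
  \prod_(j < k) (b j (vertex v s j.+1) - b j (vertex v s j)).
have faces t (j : 'I_k) x :
    (x j = 0%N -> hyb t j x = 0) /\ (x j = N.+1 -> hyb t j x = 1).
  by split => xj; rewrite /hyb /lab /std xj ?(l0 _ _ xj) ?(l1 _ _ xj) if_same.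
have step t : (t < k)%N -> total (hyb t.+1) = total (hyb t).
  move=> tk; apply/F2_eq; rewrite -big_split /=.
  pose i := Ordinal tk.
  pose b (j : 'I_k) x := if j == i then lab j x + std j x else hyb t j x.
  rewrite -[RHS](@coboundary_sum_eq0 i b); last 2 first.
  - move=> j x y ji xy; rewrite /b (negbTE ji).
    have [h0 h1] := faces t j x; have [g0 g1] := faces t j y.
    by case=> xj; [rewrite h0 ?g0 -?xy|rewrite h1 ?g1 -?xy].
  - move=> x; rewrite /b eqxx /lab /std => -[xi|xi]; rewrite xi ?(l0 _ _ xi) ?(l1 _ _ xi) ?addr0 //=.
    exact: addF2.
  apply: eq_bigr => v _; rewrite -big_split /=; apply: eq_bigr => s _.
  pose E j := b j (vertex v s j.+1) - b j (vertex v s j).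
  rewrite (@prodD1 i E) => [|j|j]; last 2 first.
  - move=> ji; rewrite /E /b (negbTE ji) /hyb.
    by have -> : (j < t.+1)%N = (j < t)%N by move: ji; rewrite -val_eqE /=; lia.
  - by move=> ji; rewrite /E /b (negbTE ji).
  rewrite [RHS](bigD1 i) //=; congr (_ * _).
  rewrite /b /hyb eqxx /= ltnSn ltnn.
  by rewrite addrACA opprD.
have total_lab : total lab = total std.
  have hybE t : (t <= k)%N -> total (hyb t) = total (hyb 0).
    by elim: t => // t IH tk; rewrite step // IH // ltnW.
  rewrite (_ : lab = hyb k) ?hybE //; apply: funext => j; apply: funext => x.
  by rewrite /hyb ltn_ord.
have total_std : total std = 1.
  rewrite /total (bigD1 [ffun=> ord0]) //= [X in _ + X]big1 ?addr0; last first.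
    move=> v v0; apply: big1 => s _.
    have [j vj] : exists j, v j != ord0.
      apply/existsP; apply: contraNT v0; rewrite negb_exists => /forallP v0.
      by apply/eqP/ffunP => j; rewrite ffunE; apply/eqP; rewrite -[_ == _]negbK.
    rewrite (bigD1 j) //= /std /vertex !addn_gt0.
    have -> : (0 < v j)%N by rewrite lt0n; move: vj; rewrite -val_eqE.
    by rewrite subrr mul0r.
  rewrite (bigD1 1%g) //= [X in _ + X]big1 ?addr0.
    apply: big1 => j _; rewrite /std /vertex ffunE perm1 /= !add0n.
    by rewrite ltnSn ltnn subr0.
  move=> s s1; have [j sj] : exists j, s j != j.
    apply/existsP; apply: contraNT s1; rewrite negb_exists => /forallP s1.
    by apply/eqP/permP => j; rewrite perm1; apply/eqP; rewrite -[_ == _]negbK.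
  have sj' : (s j < j.+1)%N = (s j < j)%N by move: sj; rewrite -val_eqE /=; lia.
  by rewrite (bigD1 j) //= /std /vertex ffunE sj' subrr mul0r.
apply: contrapT => nex.
have : total lab = 0.
  apply: big1 => v _; apply: big1 => s _.
  have [j lj] : exists j : 'I_k, l j (vertex v s j.+1) = l j (vertex v s j).
    apply: contrapT => nj; apply: nex; exists v, s => j.
    by apply/eqP => lj; apply: nj; exists j.
  by rewrite (bigD1 j) //= /lab lj subrr mul0r.
by rewrite total_lab total_std => /eqP; rewrite oner_eq0.
Qed.

End KuhnGrid.

(** * Null sets through covers *)

(** Being null for the k-dimensional Hausdorff measure, in terms of covers; [s i] bounds
    the diameter of [E i]. No upper bound is put on the scale, because a small sum of
    [s i ^+ k] already forces every [s i] to be small. *)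
Definition null_cover (R : realType) (T : Type) (d : T -> T -> \bar R) (k : nat) (M : set T) :=
  forall eta : R, 0 < eta -> exists (E : nat -> set T) (s : nat -> R),
    [/\ forall i, 0 <= s i, M `<=` \bigcup_i E i,
        forall i x y, E i x -> E i y -> (d x y <= (s i)%:E)%E
      & (\sum_(i <oo) (s i ^+ k)%:E <= eta%:E)%E].

Lemma hausdorff_null_cover (R : realType) (T : Type) (d : T -> T -> \bar R) (k : nat) (M : set T) :
  hausdorff_measure d k M = 0%E -> null_cover d k M.
Proof.
move=> M0 eta eta0.
have : (hausdorff_content d k 1 M < eta%:E)%E.
  apply: (@le_lt_trans _ _ 0%E); last by rewrite lte_fin.
  by rewrite -M0; apply: ereal_sup_ubound; exists 1 => //=; exact: ltr01.
move=> /ereal_inf_lt[_ [E [ME E1] <-]] Eeta.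
have fE i : ediam d (E i) = (fine (ediam d (E i)))%:E.
  rewrite fineK // fin_numElt (@lt_le_trans _ _ 0%E) ?ltNy0 //=.
    by rewrite (le_lt_trans (E1 i)) ?ltry.
  by apply: ereal_sup_ubound; left.
exists E, (fun i => fine (ediam d (E i))); split => //.
- by move=> i; rewrite fine_ge0 //; apply: ereal_sup_ubound; left.
- move=> i x y Ex Ey; rewrite -fE; apply: ereal_sup_ubound; right.
  by exists x => //; exists y.
- apply: le_trans (ltW Eeta); apply: lee_nneseries => [i _ _|i _].
    by rewrite lee_fin exprn_ge0 // fine_ge0 //; apply: ereal_sup_ubound; left.
  by rewrite EFin_expe -fE.
Qed.

Lemma null_cover_sub (R : realType) (T : Type) (d : T -> T -> \bar R) k (M N : set T) :
  M `<=` N -> null_cover d k N -> null_cover d k M.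
Proof.
move=> MN Nn eta /Nn[E [s [s0 NE dE sE]]]; exists E, s; split => //.
exact: subset_trans NE.
Qed.

(** The covers may be taken at any small scale, hence a Lipschitz bound for nearby
    points is enough. *)
Lemma null_cover_image (R : realType) (T U : Type) (dT : T -> T -> \bar R)
    (dU : U -> U -> \bar R) k (M : set T) (f : T -> U) (e C : R) :
  (0 < k)%N -> 0 < e -> 0 <= C ->
  (forall x y, M x -> M y -> (dT x y < e%:E)%E -> (dU (f x) (f y) <= C%:E * dT x y)%E) ->
  null_cover dT k M -> null_cover dU k (f @` M).
Proof.
move=> k0 e0 C0 fL Mn eta eta0.
have e2 : 0 < e / 2 by rewrite divr_gt0.
have C1 : 0 < C ^+ k + 1 by rewrite ltr_wpDl ?exprn_ge0.
have eta'0 : 0 < Num.min ((e / 2) ^+ k) (eta / (C ^+ k + 1)).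
  by rewrite lt_min exprn_gt0 //= divr_gt0.
have [E [s [s0 ME dE sE]]] := Mn _ eta'0.
(* the first bound on the sum keeps all sets at scale [e / 2], the second one absorbs [C ^+ k] *)
have sle i : s i <= e / 2.
  rewrite -(@ler_pXn2r _ k) ?nnegrE // ?(ltW e2) // -lee_fin.
  apply: (@le_trans _ _ (\sum_(i <oo) (s i ^+ k)%:E)%E); last first.
    by apply: (le_trans sE); rewrite lee_fin ge_min lexx.
  apply: (@le_trans _ _ (\sum_(0 <= j < i.+1) (s j ^+ k)%:E)%E); last first.
    by apply: nneseries_lim_ge => n _ _; rewrite lee_fin exprn_ge0.
  rewrite big_nat_recr //= leeDr // sume_ge0 // => j _.
  by rewrite lee_fin exprn_ge0.
exists (fun i => f @` (E i `&` M)), (fun i => C * s i); split.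
- by move=> i; rewrite mulr_ge0.
- move=> _ [x Mx <-]; have [i _ Ex] := ME _ Mx.
  by exists i => //; exists x.
- move=> i _ _ [x [Ex Mx] <-] [y [Ey My] <-].
  have dxy := dE _ _ _ Ex Ey.
  apply: (@le_trans _ _ (C%:E * dT x y)%E).
    apply: fL => //; apply: (le_lt_trans dxy); rewrite lte_fin.
    by apply: (le_lt_trans (sle i)); rewrite ltr_pdivrMr // ltr_pMr // ltr1n.
  by rewrite EFinM lee_wpmul2l // lee_fin.
- under eq_eseriesr do rewrite exprMn EFinM.
  rewrite nneseriesZl; last by move=> i _; rewrite lee_fin exprn_ge0.
  apply: (@le_trans _ _ ((C ^+ k)%:E * (eta / (C ^+ k + 1))%:E)%E).
    rewrite lee_wpmul2l ?lee_fin ?exprn_ge0 //.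
    by apply: (le_trans sE); rewrite lee_fin ge_min lexx orbT.
  by rewrite -EFinM lee_fin mulrA ler_pdivrMr // mulrDr mulr1 [leLHS]mulrC lerDl ltW.
Qed.

(** A single enumeration of pairs, to concatenate countably many countable covers. *)
Lemma sum_pairing (R : realType) : exists pi : nat -> nat * nat, bijective pi /\
  forall a : nat -> nat -> R, (forall m i, 0 <= a m i) ->
  (\sum_(n <oo) (a (pi n).1 (pi n).2)%:E = \sum_(m <oo) \sum_(i <oo) (a m i)%:E)%E.
Proof.
have [pi pib] : exists pi : nat -> nat * nat, set_bij [set: nat] [set: nat * nat] pi.
  by apply/card_set_bijP; rewrite card_eq_sym card_nat2.
exists pi; split; first by rewrite -setTT_bijective.
move=> a a0; rewrite nneseries_esumT; last by move=> n; rewrite lee_fin.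
rewrite -(@reindex_esum _ _ _ _ _ pi (fun p => (a p.1 p.2)%:E) pib).
rewrite nneseries_esumT; last by move=> m; apply: nneseries_ge0 => *; rewrite lee_fin.
transitivity (\esum_(m in [set: nat]) \esum_(i in [set: nat]) (a m i)%:E)%E.
  rewrite (@esum_esum _ _ _ [set: nat] (fun=> [set: nat])) //; last by move=> *; rewrite lee_fin.
  by congr (esum _ _); apply/seteqP; split=> -[x y].
apply: eq_esum => m _; rewrite nneseries_esumT // => i; by rewrite lee_fin.
Qed.

Definition supdist (R : realType) (k : nat) (x y : 'rV[R]_k) : \bar R := (`|x - y|)%:E.

(** If the sum exceeded [2 * C] for every [t] in the unit interval, its integral would
    exceed [C]; but the n-th term has integral at most [w n * (2 * s n)]. *)
Lemma averaging1 (R : realType) (w c s : nat -> R) (C : R) :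
  0 < C -> (forall n, 0 <= w n) -> (forall n, 0 <= s n) ->
  (\sum_(n <oo) (w n * (2 * s n))%:E <= C%:E)%E ->
  exists2 t, 0 <= t <= 1 &
    (\sum_(n <oo) (w n * (`|t - c n| <= s n)%R%:R)%:E <= (2 * C)%:E)%E.
Proof.
move=> C0 w0 s0 wC; apply: contrapT => nex.
pose I n : set (measurableTypeR R) := [set t : R | `|t - c n| <= s n].
have IE n : I n = `[c n - s n, c n + s n]%classic.
  by apply/seteqP; split => t; rewrite /I /= in_itv /= ler_distl.
have mI n : measurable (I n) by rewrite IE.
have mwI n (D : set (measurableTypeR R)) : measurable_fun D (fun t => (w n * \1_(I n) t)%:E).
  apply/measurable_EFinP; apply: measurable_funM; first exact: measurable_cst.
  exact: measurable_indic.
have big t : `[0, 1]%classic t -> ((2 * C)%:E <= \sum_(n <oo) (w n * \1_(I n) t)%:E)%E.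
  move=> t01; rewrite leNgt; apply/negP => lt; apply: nex.
  exists t; first by move: t01; rewrite /= in_itv.
  apply: le_trans (ltW lt); apply: lee_nneseries => [n _ _|n _].
    by rewrite lee_fin mulr_ge0.
  have -> : \1_(I n) t = (`|t - c n| <= s n)%R%:R :> R by rewrite indicE mem_setE.
  by [].
have : ((2 * C)%:E <= C%:E)%E.
  apply: le_trans wC.
  have -> : ((2 * C)%:E = \int[@lebesgue_measure R]_(t in `[0%R, 1%R]) (2 * C)%:E)%E.
    by rewrite integral_cst //= lebesgue_measure_itv /= lte_fin ltr01 oppr0 adde0 mule1.
  apply: (@le_trans _ _ (\int[@lebesgue_measure R]_(t in `[0%R, 1%R])
      \sum_(n <oo) (w n * \1_(I n) t)%:E)%E).
    apply: ge0_le_integral => //.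
    - by move=> t _; rewrite lee_fin mulr_ge0 // ltW.
    - apply: ge0_emeasurable_sum => [n t _ _|n _]; first by rewrite lee_fin mulr_ge0.
      exact: mwI.
  rewrite integral_nneseries //.
  - apply: lee_nneseries => [n _ _|n _].
      by apply: integral_ge0 => t _; rewrite lee_fin mulr_ge0.
    under eq_integral do rewrite EFinM.
    rewrite ge0_integralZl //; [|by apply/measurable_EFinP; exact: measurable_indic (mI n)|by rewrite lee_fin].
    rewrite integral_indic; [|by []|exact: mI].
    rewrite EFinM lee_wpmul2l ?lee_fin //.
    apply: (@le_trans _ _ (lebesgue_measure (I n))).
      by apply: le_measure; rewrite ?inE //; exact: measurableI.
    rewrite IE lebesgue_measure_itv /= lte_fin; case: ifP => _; last by rewrite lee_fin mulr_ge0.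
    by rewrite -EFinB lee_fin; lra.
  - by move=> n t _; rewrite lee_fin mulr_ge0.
by rewrite lee_fin; lra.
Qed.

(** Fubini by hand: the coordinates of [p] are chosen one after the other, each at the
    price of a factor 2. The sum that remains counts the boxes with centre [c n] and
    half-width [s n] whose projection along the missing coordinates contains [p]. *)
Lemma averaging (R : realType) (I : eqType) (c : nat -> I -> R) (s : nat -> R) (js : seq I)
    (w : nat -> R) (C : R) :
  uniq js -> 0 < C -> (forall n, 0 <= w n) -> (forall n, 0 <= s n) ->
  (\sum_(n <oo) (w n * (2 * s n) ^+ size js)%:E <= C%:E)%E ->
  exists p : I -> R, (forall j, 0 <= p j <= 1) /\
    (\sum_(n <oo) (w n * (all (fun j => `|p j - c n j| <= s n)%R js)%:R)%:E
       <= (2 ^+ size js * C)%:E)%E.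
Proof.
elim: js w C => [|j js IH] w C /=.
  move=> _ C0 w0 s0 wC; exists (fun=> 0); split; first by move=> ?; rewrite lexx ler01.
  by under eq_eseriesr do rewrite mulr1; rewrite mul1r; under eq_eseriesr do rewrite -[w _]mulr1.
move=> /andP[jjs ujs] C0 w0 s0 wC.
have s20 n : 0 <= 2 * s n by rewrite mulr_ge0.
have [t t01 tC] : exists2 t, 0 <= t <= 1 & (\sum_(n <oo)
    (w n * (2 * s n) ^+ size js * (`|t - c n j| <= s n)%R%:R)%:E <= (2 * C)%:E)%E.
  apply: averaging1 => //; first by move=> n; rewrite mulr_ge0 ?exprn_ge0.
  by under eq_eseriesr do rewrite -mulrA -exprSr.
have [p [p01 pC]] := IH (fun n => w n * (`|t - c n j| <= s n)%R%:R) (2 * C) ujs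
  (mulr_gt0 (ltr0Sn _ _) C0) (fun n => mulr_ge0 (w0 n) (ler0n _ _)) s0
  (eq_ind _ (fun x => (x <= _)%E) tC _ (eq_eseriesr (fun n _ => congr1 EFin (mulrAC _ _ _)))).
exists (fun i => if i == j then t else p i); split; first by move=> i; case: ifP.
rewrite exprSr -mulrA; apply: le_trans pC; apply: lee_nneseries => [n _ _|n _].
  by rewrite lee_fin mulr_ge0.
rewrite lee_fin eqxx -mulrA ler_wpM2l // -natrM mulnb ler_nat.
have -> // : all (fun i => `|(if i == j then t else p i) - c n i| <= s n) js =
  all (fun i => `|p i - c n i| <= s n) js.
apply: eq_in_all => i ijs; case: eqP => // ij; by rewrite -ij ijs in jjs.
Qed.

Definition set_coord (R : realType) k (p : 'rV[R]_k) (i0 : 'I_k) (t : R) : 'rV[R]_k :=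
  \row_j (if j == i0 then t else p 0 j).

(** Concatenating covers with sums 1/2, 1/4, ... covers every point infinitely often
    with a finite sum, as needed for the Borel-Cantelli lemma. *)
Lemma null_cover_io (R : realType) k (M : set 'rV[R]_k) :
  null_cover (@supdist R k) k M ->
  exists (c : nat -> 'rV[R]_k) (s : nat -> R), [/\ forall n, 0 <= s n,
    (\sum_(n <oo) (s n ^+ k)%:E <= 1)%E &
    forall x m, M x -> exists2 n, (m <= n)%N & forall j, `|x 0 j - c n 0 j| <= s n].
Proof.
move=> Mn; have [pi [[pi' pi'K piK] sumpi]] := sum_pairing R.
have eta0 m : 0 < (1 / (2 ^ m.+1)%:R : R) by rewrite divr_gt0 // ltr0n expn_gt0.
have /choice[Es EsP] m := (Mn _ (eta0 m)).
have /choice[ss ssP] m := EsP m.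
pose a m i := ss m i ^+ k.
have ss0 m i : 0 <= ss m i by have [] := ssP m.
exists (fun n => xget 0 (Es (pi n).1 (pi n).2)), (fun n => ss (pi n).1 (pi n).2); split => //.
  rewrite (sumpi a); last by move=> m i; rewrite exprn_ge0.
  apply: (le_trans _ (@epsilon_trick0 R 1 xpredT ler01)).
  apply: lee_nneseries => [m _ _|m _].
    by apply: nneseries_ge0 => *; rewrite lee_fin exprn_ge0.
  by have [] := ssP m.
(* the q-th cover for a [q] that none of the first [m] sets comes from *)
move=> x m Mx; pose q := (\max_(n < m) (pi n).1).+1.
have [_ /(_ x Mx)[i _ Ex] dE _] := ssP q.
exists (pi' (q, i)).
  rewrite leqNgt; apply/negP => lt.
  have := @leq_bigmax _ (fun n : 'I_m => (pi n).1) (Ordinal lt).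
  by rewrite /= piK /= -/q ltnn.
move=> j; rewrite piK /=; rewrite -lee_fin.
apply: le_trans (dE i x (xget 0 (Es q i)) Ex _); last by apply: xgetI Ex.
rewrite lee_fin; apply: le_trans (coord_le_norm _ j).
by rewrite !mxE.
Qed.

(** A Fubini type statement. The line in direction [i0] through [p] meets the n-th box
    of a cover in an interval of length at most [2 * s n], or not at all; averaging over
    the other coordinates makes the sum of these lengths finite, and by Borel-Cantelli
    almost no point of the line lies in infinitely many boxes. *)
Lemma null_slice (R : realType) k (M : set 'rV[R]_k) (i0 : 'I_k) :
  null_cover (@supdist R k) k M ->
  exists p : 'rV[R]_k, (forall j, 0 <= p 0 j <= 1) /\
    (@lebesgue_measure R).-negligible [set t | M (set_coord p i0 t)].
Proof.
move=> /null_cover_io[c [s [s0 sums io]]].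
pose js := rem i0 (enum 'I_k).
have sz : size js = k.-1 by rewrite size_rem ?mem_enum // size_enum_ord.
have ujs : uniq js by rewrite rem_uniq // enum_uniq.
have k0 : (0 < k)%N by rewrite (leq_ltn_trans _ (ltn_ord i0)).
have [p [p01 pC]] : exists p : 'I_k -> R, (forall j, 0 <= p j <= 1) /\
    (\sum_(n <oo) (2 * s n * (all (fun j => `|p j - c n 0 j| <= s n)%R js)%:R)%:E
       <= (2 ^+ size js * 2 ^+ k)%:E)%E.
  apply: averaging => //; first by move=> n; rewrite mulr_ge0.
  under eq_eseriesr do rewrite -exprS sz prednK // exprMn EFinM.
  rewrite nneseriesZl; last by move=> i _; rewrite lee_fin exprn_ge0.
  by rewrite -[leRHS]mule1 lee_wpmul2l // lee_fin exprn_ge0.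
exists (\row_j p j); split; first by move=> j; rewrite mxE.
pose P n := all (fun j => `|p j - c n 0 j| <= s n) js.
pose I n : set (measurableTypeR R) := if P n then `[c n 0 i0 - s n, c n 0 i0 + s n]%classic else set0.
have mI n : measurable (I n) by rewrite /I; case: ifP.
exists (lim_sup_set I); split.
- by apply: bigcap_measurable => // n _; exact: bigcup_measurable.
- apply: lim_sup_set_cvg0 => //; apply: (le_lt_trans _ (ltry (2 ^+ size js * 2 ^+ k))).
  apply: le_trans pC; apply: lee_nneseries => // n _.
  rewrite /I -/(P n); case: (P n) => /=; last by rewrite measure0 mulr0.
  have -> := @lebesgue_measure_itv R `[c n 0 i0 - s n, c n 0 i0 + s n]%R.
  rewrite /= lte_fin mulr1; case: ifP => _; last by rewrite lee_fin mulr_ge0.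
  by rewrite -EFinB lee_fin; lra.
- move=> t /= Mt m _; have [n mn xn] := io _ m Mt.
  exists n => //; rewrite /I; have -> : P n.
    apply/allP => j jjs; have := xn j; rewrite !mxE; case: eqP => // ji.
    by move: jjs; rewrite ji /js mem_rem_uniq ?enum_uniq // inE eqxx.
  by rewrite /= in_itv /= -ler_distl; have := xn i0; rewrite mxE eqxx.
Qed.

Lemma null_coverU (R : realType) (T : Type) (d : T -> T -> \bar R) k (M : nat -> set T) :
  (forall m, null_cover d k (M m)) -> null_cover d k (\bigcup_m M m).
Proof.
move=> Mn eta e0; have [pi [[pi' pi'K piK] sumpi]] := sum_pairing R.
have eta0 m : 0 < (eta / (2 ^ m.+1)%:R : R) by rewrite divr_gt0 // ltr0n expn_gt0.
have /choice[Es EsP] m := (Mn m _ (eta0 m)).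
have /choice[ss ssP] m := EsP m.
have ss0 m i : 0 <= ss m i by have [] := ssP m.
exists (fun n => Es (pi n).1 (pi n).2), (fun n => ss (pi n).1 (pi n).2); split => //.
- move=> x [m _ Mx]; have [_ /(_ x Mx)[i _ Ex] _ _] := ssP m.
  by exists (pi' (m, i)) => //; rewrite piK.
- by move=> n x y; have [_ _ + _] := ssP (pi n).1; apply.
- rewrite (sumpi (fun m i => ss m i ^+ k)); last by move=> m i; rewrite exprn_ge0.
  apply: (le_trans _ (@epsilon_trick0 R eta xpredT (ltW e0))).
  apply: lee_nneseries => [m _ _|m _].
    by apply: nneseries_ge0 => *; rewrite lee_fin exprn_ge0.
  by have [] := ssP m.
Qed.

(** * Broken lines avoiding a null set *)

Lemma divr_lipschitz (R : realType) (B tau a a' s s' : R) :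
  0 < tau -> tau <= s <= 1 -> tau <= s' <= 1 -> `|a| <= B ->
  `|a / s - a' / s'| <= (B * `|s - s'| + `|a - a'|) / tau ^+ 2.
Proof.
move=> tau0 /andP[ts s1] /andP[ts' s'1] aB.
have s0 : 0 < s by exact: lt_le_trans ts.
have s'0 : 0 < s' by exact: lt_le_trans ts'.
have -> : a / s - a' / s' = (a * (s' - s) + s * (a - a')) / (s * s').
  by field; rewrite !gt_eqF.
have B0 : 0 <= B by exact: le_trans aB.
rewrite normrM normfV (ger0_norm (ltW (mulr_gt0 s0 s'0))).
apply: ler_pM => //; first by rewrite invr_ge0 mulr_ge0 // ltW.
  apply: (le_trans (ler_normD _ _)); apply: lerD.
    by rewrite normrM (distrC s') ler_wpM2r.
  by rewrite normrM (ger0_norm (ltW s0)) ler_piMl.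
by rewrite lef_pV2 ?posrE ?mulr_gt0 ?exprn_gt0 // expr2 ler_pM // ltW.
Qed.

Section Cone.
Variables (R : realType) (k : nat) (i0 : 'I_k) (x b : 'rV[R]_k) (r h : R).
Hypotheses (r0 : 0 < r) (h0 : 0 < h).

(** Broken lines come from cones: the base is a cube of side [r] in the hyperplane
    at height [h] above the apex [x] in direction [i0]. A point of the cone is described
    by its relative height [q 0 i0] and by the point of the base on the same ray from
    the apex, given by the other coordinates of [q]. *)
Definition cone_base (p : 'rV[R]_k) : 'rV[R]_k :=
  \row_j (if j == i0 then x 0 i0 + h else b 0 j + r * p 0 j).

Definition cone_point (q : 'rV[R]_k) : 'rV[R]_k :=
  x + q 0 i0 *: (cone_base q - x).

Definition cone_param (z : 'rV[R]_k) : 'rV[R]_k :=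
  \row_j (if j == i0 then (z 0 i0 - x 0 i0) / h
          else ((z 0 j - x 0 j) / ((z 0 i0 - x 0 i0) / h) + x 0 j - b 0 j) / r).

Lemma cone_pointK (q : 'rV[R]_k) : q 0 i0 != 0 -> cone_param (cone_point q) = q.
Proof.
move=> q0; apply/rowP => j; rewrite !mxE eqxx.
have h1 : h != 0 by rewrite gt_eqF.
have r1 : r != 0 by rewrite gt_eqF.
case: eqP => [->|_]; first by field.
by field; rewrite r1 h1 (_ : _ - _ = q 0 i0 * h) ?mulf_neq0 //; ring.
Qed.

(** A Lipschitz image of a null set is null, and the inverse [cone_param] of the
    parametrisation is Lipschitz at relative heights bounded away from 0; the cone
    without apex is a countable union of such pieces. *)
Lemma null_cone (N : set 'rV[R]_k) :
  null_cover (@supdist R k) k N ->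
  null_cover (@supdist R k) k
    [set q : 'rV[R]_k | (forall j, 0 <= q 0 j <= 1) /\ 0 < q 0 i0 /\ N (cone_point q)].
Proof.
move=> Nn.
pose Q m := [set q : 'rV[R]_k | [/\ forall j, 0 <= q 0 j <= 1, m.+1%:R^-1 <= q 0 i0
  & N (cone_point q)]].
have QE : [set q : 'rV[R]_k | (forall j, 0 <= q 0 j <= 1) /\ 0 < q 0 i0 /\ N (cone_point q)]
    `<=` \bigcup_m Q m.
  move=> q [q01 [q0 Nq]]; exists (Num.truncn (q 0 i0)^-1) => //; split=> //.
  rewrite -[leRHS]invrK lef_pV2 ?posrE ?invr_gt0 ?ltr0Sn //.
  by apply/ltW/truncnS_gt.
apply: (null_cover_sub QE); apply: null_coverU => m.
have kgt0 : (0 < k)%N by rewrite (leq_ltn_trans _ (ltn_ord i0)).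
pose tau : R := m.+1%:R^-1.
have tau0 : 0 < tau by rewrite invr_gt0 ltr0Sn.
(* [B] bounds the coordinates of the cone relative to its apex *)
pose B := h + `|b - x| + r.
have B0 : 0 <= B by rewrite !addr_ge0 // ltW.
pose C := h^-1 + (B / h + 1) / tau ^+ 2 / r.
have h1 : 0 <= h^-1 by rewrite invr_ge0 ltW.
have h2 : 0 <= (B / h + 1) / tau ^+ 2 / r.
  apply: divr_ge0; last exact: ltW.
  apply: divr_ge0; last exact: sqr_ge0.
  by apply: addr_ge0 => //; exact: mulr_ge0.
have C0 : 0 <= C by exact: addr_ge0.
apply: (@null_cover_sub _ _ _ _ _ (cone_param @` (cone_point @` Q m))).
  move=> q Qq; exists (cone_point q); first by exists q.
  apply: cone_pointK; case: Qq => _ tq _.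
  by rewrite gt_eqF // (lt_le_trans _ tq).
apply: (@null_cover_image _ _ _ (@supdist R k) _ _ _ _ 1 C) => //; last first.
  by apply: null_cover_sub Nn => _ [q [_ _ Nq] <-].
move=> _ _ [q Qq <-] [q' Qq' <-] _; rewrite -EFinM lee_fin.
have zE (q1 : 'rV[R]_k) : (cone_point q1 0 i0 - x 0 i0) / h = q1 0 i0.
  by rewrite !mxE eqxx; field; rewrite gt_eqF.
set z := cone_point q; set z' := cone_point q'.
have zz' j : `|z 0 j - z' 0 j| <= `|z - z'|.
  by apply: le_trans (coord_le_norm _ j); rewrite !mxE.
have qq' : `|(z 0 i0 - x 0 i0) / h - (z' 0 i0 - x 0 i0) / h| <= `|z - z'| / h.
  rewrite -mulrBl normrM normfV (ger0_norm (ltW h0)) ler_wpM2r //.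
  by rewrite (_ : _ - _ = z 0 i0 - z' 0 i0) //; ring.
apply: norm_le_coord; first by rewrite mulr_ge0.
move=> j; rewrite [X in `|X|]mxE [in X in X + _]mxE [in X in _ + X]mxE [in X in _ + X]mxE.
case: ifP => ji.
  by apply: (le_trans qq'); rewrite mulrC ler_wpM2r // lerDl.
set s := (z 0 i0 - x 0 i0) / h in qq' *; set s' := (z' 0 i0 - x 0 i0) / h in qq' *.
have -> : ((z 0 j - x 0 j) / s + x 0 j - b 0 j) / r - ((z' 0 j - x 0 j) / s' + x 0 j - b 0 j) / r =
  ((z 0 j - x 0 j) / s - (z' 0 j - x 0 j) / s') / r by ring.
have aB : `|z 0 j - x 0 j| <= B.
  have [q01 _ _] := Qq.
  have -> : z 0 j - x 0 j = q 0 i0 * ((b - x) 0 j + r * q 0 j).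
    by rewrite !mxE ji; ring.
  have /andP[qi0 qi1] := q01 i0; have /andP[qj0 qj1] := q01 j.
  rewrite normrM (ger0_norm qi0) -[leRHS]mul1r; apply: ler_pM => //.
  apply: (le_trans (ler_normD _ _)); apply: lerD.
    by apply: (le_trans (coord_le_norm _ j)); rewrite lerDr ltW.
  by rewrite normrM (gtr0_norm r0) (ger0_norm qj0) ler_piMr // ltW.
have Qs (q1 : 'rV[R]_k) : Q m q1 -> tau <= (cone_point q1 0 i0 - x 0 i0) / h <= 1.
  by move=> [q01 tq _]; rewrite zE tq /=; have /andP[] := q01 i0.
rewrite normrM normfV (gtr0_norm r0).
apply: (@le_trans _ _ ((B * (`|z - z'| / h) + `|z - z'|) / tau ^+ 2 / r)).
  rewrite ler_wpM2r ?invr_ge0 ?(ltW r0) //.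
  apply: (le_trans (@divr_lipschitz R B tau _ (z' 0 j - x 0 j) s s' tau0 (Qs _ Qq) (Qs _ Qq') aB)).
  rewrite ler_wpM2r ?invr_ge0 ?sqr_ge0 // lerD //; first by rewrite ler_wpM2l.
  by rewrite (_ : _ - _ = z 0 j - z' 0 j) //; ring.
rewrite (_ : _ / r = (B / h + 1) / tau ^+ 2 / r * `|z - z'|); last by ring.
by rewrite ler_wpM2r // lerDr.
Qed.

End Cone.

(** The second segment of the broken line is run backwards, at times in [[1, 2]]. *)
Definition flip_coord (R : realType) k (i0 : 'I_k) (q : 'rV[R]_k) : 'rV[R]_k :=
  set_coord q i0 (2 - q 0 i0).

Lemma null_cover_flip (R : realType) k (i0 : 'I_k) (M : set 'rV[R]_k) :
  null_cover (@supdist R k) k M ->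
  null_cover (@supdist R k) k [set q | M (flip_coord i0 q)].
Proof.
move=> Mn; have k0 : (0 < k)%N by rewrite (leq_ltn_trans _ (ltn_ord i0)).
apply: (@null_cover_sub _ _ _ _ _ (flip_coord i0 @` M)).
  move=> q /= Mq; exists (flip_coord i0 q) => //.
  apply/rowP => j; rewrite !mxE eqxx; case: eqP => // ->.
  by rewrite opprB addrCA subrr addr0.
apply: (@null_cover_image _ _ _ (@supdist R k) _ _ _ _ 1 1) => // p q _ _ _.
rewrite mul1e lee_fin; apply: norm_le_coord => // j; rewrite !mxE.
have pq i : `|p 0 i - q 0 i| <= `|p - q| by apply: le_trans (coord_le_norm _ i); rewrite !mxE.
case: eqP => _ /=; last exact: pq.
have -> : 2 - p 0 i0 - (2 - q 0 i0) = - (p 0 i0 - q 0 i0) by ring.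
by rewrite normrN.
Qed.

(** The cones with apexes [x] and [x'] are given a common base, parametrised in the same
    way. In these parameters both preimages of [N] are null, and [null_slice] provides
    a single base point [y] that is good for both segments. *)
Lemma generic_broken_line (R : realType) (k : nat) (N : set 'rV[R]_k) (x x' : 'rV[R]_k) (r : R) :
  (0 < k)%N -> null_cover (@supdist R k) k N -> 0 < r -> `|x - x'| <= r ->
  exists y : 'rV[R]_k, [/\ `|y - x| <= 2 * r, `|y - x'| <= 2 * r,
    (@lebesgue_measure R).-negligible [set t | 0 < t <= 1 /\ N (x + t *: (y - x))] &
    (@lebesgue_measure R).-negligible [set t | 1 <= t < 2 /\ N (x' + (2 - t) *: (y - x'))]].
Proof.
case: k N x x' => // k N x x' _ Nn r0 xr.
(* the common base lies in the hyperplane at level [c], at distance between [r] and [2 * r]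
   from both apexes *)
pose c := Num.max (x 0 ord0) (x' 0 ord0) + r.
have hc (z : R) : z <= Num.max (x 0 ord0) (x' 0 ord0) -> 0 < c - z.
  by move=> zm; rewrite subr_gt0 (le_lt_trans zm) // ltrDl.
have xc : 0 < c - x 0 ord0 by apply: hc; rewrite le_max lexx.
have x'c : 0 < c - x' 0 ord0 by apply: hc; rewrite le_max lexx orbT.
pose M1 := [set q : 'rV[R]_k.+1 | (forall j, 0 <= q 0 j <= 1) /\ 0 < q 0 ord0 /\
  N (cone_point ord0 x x' r (c - x 0 ord0) q)].
pose M2 := [set q : 'rV[R]_k.+1 | (forall j, 0 <= q 0 j <= 1) /\ 0 < q 0 ord0 /\
  N (cone_point ord0 x' x' r (c - x' 0 ord0) q)].
pose M m := if m is 0%N then M1 else [set q | M2 (flip_coord ord0 q)].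
have MN m : null_cover (@supdist R k.+1) k.+1 (M m).
  case: m => [|m]; first exact: null_cone.
  exact/null_cover_flip/null_cone.
have [p [p01 negp]] := null_slice ord0 (null_coverU MN).
pose y := cone_base ord0 x x' r (c - x 0 ord0) p.
have yE : y = cone_base ord0 x' x' r (c - x' 0 ord0) p.
  by apply/rowP => j; rewrite !mxE; case: ifP => // _; rewrite !subrKC.
have set_coord_base z h t : cone_base ord0 z x' r h (set_coord p ord0 t) = cone_base ord0 z x' r h p.
  by apply/rowP => j; rewrite !mxE; case: ifP => // ->.
have flipE t : flip_coord ord0 (set_coord p ord0 t) = set_coord p ord0 (2 - t).
  by apply/rowP => j; rewrite !mxE eqxx; case: ifP => // ->.
have p01' t : 0 <= t <= 1 -> forall j, 0 <= set_coord p ord0 t 0 j <= 1.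
  by move=> t01 j; rewrite mxE; case: ifP.
have xx' j : `|x 0 j - x' 0 j| <= r.
  by apply: le_trans xr; apply: le_trans (coord_le_norm _ j); rewrite !mxE.
have r2 : 0 <= 2 * r by rewrite mulr_ge0 // ltW.
exists y; split.
- apply: norm_le_coord => // j; rewrite !mxE; have := xx' j; case: eqP => [->|_].
    rewrite subrKC -/c /c; have := xx' ord0; rewrite !ler_norml.
    by case: (leP (x 0 ord0)) => _ /andP[] *; apply/andP; split; lra.
  by have /andP[] := p01 j; rewrite !ler_norml => ? ? /andP[] *; apply/andP; split; nra.
- apply: norm_le_coord => // j; rewrite !mxE; have := xx' j; case: eqP => [->|_].
    rewrite subrKC -/c /c; have := xx' ord0; rewrite !ler_norml.
    by case: (leP (x 0 ord0)) => _ /andP[] *; apply/andP; split; lra.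
  by have /andP[] := p01 j; rewrite !ler_norml => ? ? /andP[] *; apply/andP; split; nra.
- apply: negligibleS negp => t /= [/andP[t0 t1] Nt]; exists 0%N => //=.
  split; first by apply: p01'; rewrite ltW.
  by rewrite /cone_point mxE eqxx set_coord_base.
- apply: negligibleS negp => t /= [/andP[t0 t1] Nt]; exists 1%N => //=.
  rewrite flipE; split; first by apply: p01'; apply/andP; split; lra.
  by rewrite /cone_point mxE eqxx set_coord_base -yE subr_gt0.
Qed.

(** * Left translations and horizontal frames *)

Lemma row_sum_basis (R : realType) n (v : 'rV[R]_n) : v = \sum_i v 0 i *: basis_vec R n i.
Proof.
apply/rowP => j; rewrite summxE (bigD1 j) //= !mxE eqxx mulr1 big1 ?addr0 // => i ij.
rewrite !mxE.
by have -> : (j == i :> nat) = false; rewrite ?mulr0 //; apply/negbTE; rewrite eq_sym.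
Qed.

Lemma norm_basis (R : realType) n j : `|basis_vec R n j| <= 1.
Proof.
apply: norm_le_coord => // i; rewrite mxE; case: eqP => _.
  by rewrite normr1.
by rewrite normr0 ler01.
Qed.

Lemma is_derive_line (R : realType) (V W : normedModType R) (g : V -> W) (y v : V) (s : R) :
  derivable g (y + s *: v) v ->
  is_derive s (1 : R) (fun s : R => g (y + s *: v)) ('D_v g (y + s *: v)).
Proof.
have E : (fun h : R => h^-1 *: (((fun s => g (y + s *: v)) \o shift s) (h *: (1:R)) - g (y + s *: v)))
  = (fun h => h^-1 *: ((g \o shift (y + s *: v)) (h *: v) - g (y + s *: v))).
  apply: funext => h /=; have -> : h *: (1 : R) = h by rewrite /GRing.scale /= mulr1.
  by rewrite scalerDl addrCA.
by move=> dg; split; rewrite /derivable /derive E.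
Qed.

Lemma mean_value_bound (R : realType) n (phi dphi : R -> 'rV[R]_n) (c : 'rV[R]_n) (a e : R) :
  0 <= e -> (forall s : R, is_derive s (1 : R) phi (dphi s)) ->
  (forall s, `|s| <= `|a| -> `|dphi s - c| <= e) ->
  `|phi a - phi 0 - a *: c| <= e * `|a|.
Proof.
move=> e0 dphiP dphie; apply: norm_le_coord => [|j]; first by rewrite mulr_ge0.
have dj (s : R) : is_derive s (1 : R) (fun s => phi s 0 j) (dphi s 0 j).
  have [d1 d2] := dphiP s; split; first by move/derivable_mxP: d1; apply.
  by rewrite -d2 derive_mx // mxE.
have cont : continuous (fun s => phi s 0 j).
  by move=> s; apply/differentiable_continuous/derivable1_diffP; have [] := dj s.
have [s sa E] : exists2 s, `|s| <= `|a| & phi a 0 j - phi 0 0 j = dphi s 0 j * a.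
  have [a0|a0] := leP 0 a.
    have [s] := MVT_segment a0 (fun s _ => dj s) (continuous_subspaceT cont).
    rewrite in_itv /= subr0 => /andP[s0 sa] ->; exists s => //.
    by rewrite !ger0_norm.
  have [s] := MVT_segment (ltW a0) (fun s _ => dj s) (continuous_subspaceT cont).
  rewrite in_itv /= sub0r mulrN => /andP[s0 sa] E; exists s => //.
    by rewrite !ler0_norm ?lerN2 // ltW.
  by rewrite -[LHS]opprB E opprK.
rewrite !mxE E mulrC -mulrBr normrM mulrC ler_wpM2r //.
by apply: le_trans (dphie s sa); apply: le_trans (coord_le_norm _ j); rewrite !mxE.
Qed.

Lemma mulmxr_bound (R : realType) n m (A : 'M[R]_(n, m)) :
  exists2 C, 0 <= C & forall v : 'rV[R]_n, `|v *m A| <= C * `|v|.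
Proof.
have A0 (j : 'I_m) : 0 <= \sum_i `|A i j| by exact: sumr_ge0.
exists (\sum_j \sum_i `|A i j|) => [|v]; first by apply: sumr_ge0.
apply: norm_le_coord => [|j]; first by rewrite mulr_ge0 ?sumr_ge0.
rewrite mxE; apply: (le_trans (ler_norm_sum _ _ _)).
apply: (@le_trans _ _ ((\sum_i `|A i j|) * `|v|)).
  rewrite mulr_suml; apply: ler_sum => i _; rewrite normrM mulrC ler_wpM2l //.
  exact: coord_le_norm.
by rewrite ler_wpM2r // (bigD1 j) //= lerDl sumr_ge0.
Qed.

Lemma mulmxr_continuous (R : realType) n m (A : 'M[R]_(n, m)) :
  continuous (mulmxr A : 'rV[R]_n -> 'rV[R]_m).
Proof.
have [C C0 CA] := mulmxr_bound A.
move=> x; apply/(@cvgrPdist_le R _ _ (nbhs x)) => e e0.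
have d0 : 0 < e / (C + 1) by rewrite divr_gt0 // ltr_wpDl.
apply: filterS (nbhsx_ballx x _ d0) => y; rewrite -ball_normE /= => /ltW xy.
rewrite -mulmxBl; apply: (le_trans (CA _)).
move: xy; rewrite ler_pdivlMr ?ltr_wpDl // => H; apply: le_trans H.
by rewrite mulrC ler_wpM2l // lerDl.
Qed.

Lemma differentiable_linear_approx (R : realType) (V W : normedModType R) (g : V -> W) x
    (L : {linear V -> W}) : continuous L ->
  (forall e : R, 0 < e -> \forall h \near (0 : V), `|g (x + h) - g x - L h| <= e * `|h|) ->
  differentiable g x.
Proof.
move=> cL gL.
have E : g \o shift x = cst (g x) + L +o_ 0 id.
  apply/eqaddoP => e e0; near=> h.
  rewrite /= [X in `|X| <= _](_ : _ = g (x + h) - g x - L h).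
    by near: h; exact: gL.
  by rewrite -[LHS]/(g (h + x) - (g x + L h)) opprD addrA [h + x]addrC.
have dE := diff_unique cL E.
by apply/diff_locallyP; rewrite dE.
Unshelve. all: by end_near. Qed.

(** The increment is split into steps along the coordinate axes, and on each step the
    mean value inequality compares with the partial derivative at [x]. *)
Lemma C1_differentiable (R : realType) n m (g : 'rV[R]_n -> 'rV[R]_m) x :
  (forall (i : 'I_n) y, derivable g y (basis_vec R n i)) ->
  (forall i : 'I_n, {for x, continuous ('D_(basis_vec R n i) g)}) ->
  differentiable g x.
Proof.
move=> dg cg.
pose A : 'M[R]_(n, m) := \matrix_(i, j) 'D_(basis_vec R n i) g x 0 j.
have rowA (h : 'rV[R]_n) : h *m A = \sum_(i < n) h 0 i *: 'D_(basis_vec R n i) g x.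
  apply/rowP => j; rewrite mxE summxE; apply: eq_bigr => i _.
  by rewrite !mxE.
apply: (@differentiable_linear_approx R _ _ g x (mulmxr A)) => [|e e0];
  first exact: mulmxr_continuous.
have n0 : 0 < n%:R + 1 :> R by rewrite ltr_wpDl.
pose d := e / (n%:R + 1).
have d0 : 0 < d by rewrite divr_gt0.
have : \forall y \near x, forall i : 'I_n,
    `|'D_(basis_vec R n i) g y - 'D_(basis_vec R n i) g x| <= d.
  apply: (@filter_forall _ 'I_n (fun i y => `|'D_(basis_vec R n i) g y -
    'D_(basis_vec R n i) g x| <= d) (nbhs x)) => i.
  have /(@cvgrPdist_le R _ _ (nbhs x)) /(_ d d0) := cg i.
  by apply: filterS => y; rewrite distrC.
move=> /nbhs_ballP[r /= r0 rP].
near=> h.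
have hr : `|h| < r.
  by near: h; apply/nbhs_ballP; exists r => //= z; rewrite -ball_normE /= sub0r normrN.
(* the coordinates of the increment are switched on one after the other *)
pose tr (l : nat) : 'rV[R]_n := \row_j (if (j < l)%N then h 0 j else 0).
have tr_le l : `|tr l| <= `|h|.
  apply: norm_le_coord => // j; rewrite mxE; case: ifP => _; last by rewrite normr0.
  exact: coord_le_norm.
have trS (i : 'I_n) : tr i.+1 = tr i + h 0 i *: basis_vec R n i.
  apply/rowP => j; rewrite !mxE ltnS; case: (ltngtP j i) => ji.
  - by rewrite mulr0 addr0.
  - by rewrite mulr0 addr0.
  - by rewrite mulr1 add0r; congr (h 0 _); exact/val_inj.
have step (i : 'I_n) : `|g (x + tr i.+1) - g (x + tr i) - h 0 i *: 'D_(basis_vec R n i) g x|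
    <= d * `|h|.
  pose phi s := g (x + tr i + s *: basis_vec R n i).
  have <- : phi (h 0 i) = g (x + tr i.+1) by rewrite /phi trS addrA.
  have <- : phi 0 = g (x + tr i) by rewrite /phi scale0r addr0.
  apply: (@le_trans _ _ (d * `|h 0 i|)); last by rewrite ler_wpM2l ?(ltW d0) // coord_le_norm.
  apply: (mean_value_bound (dphi := fun s =>
      'D_(basis_vec R n i) g (x + tr i + s *: basis_vec R n i))) => [|s|s sh].
  - exact: ltW.
  - exact: is_derive_line.
  apply: rP; rewrite -ball_normE /= -addrA opprD addNKr normrN.
  apply: le_lt_trans hr; apply: norm_le_coord => // j; rewrite !mxE.
  case: (ltngtP j i) => ji.
  - by rewrite mulr0 addr0; exact: coord_le_norm.
  - by rewrite mulr0 addr0 normr0.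
  - by rewrite mulr1 add0r; apply: (le_trans sh); exact: coord_le_norm.
have trn : tr n = h by apply/rowP => j; rewrite mxE ltn_ord.
have tr0 : tr 0%N = 0 by apply/rowP => j; rewrite !mxE.
have -> : g (x + h) - g x - h *m A =
    \sum_(i < n) (g (x + tr i.+1) - g (x + tr i) - h 0 i *: 'D_(basis_vec R n i) g x).
  rewrite sumrB -rowA; congr (_ - _).
  rewrite -(big_mkord xpredT (fun i => g (x + tr i.+1) - g (x + tr i))).
  by rewrite telescope_sumr // trn tr0 addr0.
apply: (le_trans (ler_norm_sum _ _ _)).
apply: (le_trans (ler_sum _ (fun i _ => step i))).
rewrite sumr_const card_ord -mulr_natl mulrA ler_wpM2r //.
rewrite /d mulrCA ler_piMr // ?(ltW e0) // ler_pdivrMr // mul1r lerDl //.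
Unshelve. all: by end_near. Qed.

Lemma closed_ball_compact (R : realType) n (x : 'rV[R]_n) (B : R) :
  compact [set y : 'rV[R]_n | `|y - x| <= B].
Proof.
apply: bounded_closed_compact.
  exists (`|x| + B); split; first exact: num_real.
  move=> M BM y /= yB; apply/ltW; apply: le_lt_trans BM.
  by rewrite -[y](subrK x) addrC (le_trans (ler_normD _ _)) // lerD2l.
have cn : continuous (fun y : 'rV[R]_n => `|y - x|).
  move=> y; apply: (@cvg_norm _ _ _ (nbhs y)).
  by apply: (@cvgB _ _ _ (nbhs y)); [exact: cvg_id|exact: cvg_cst].
apply: (@closed_comp _ _ (fun y : 'rV[R]_n => `|y - x|) [set r | r <= B]); last exact: closed_le.
by move=> y _; exact: cn.
Qed.

Lemma continuous_bounded_ball (R : realType) n (V : normedModType R) (F : 'rV[R]_n -> V) (B : R) :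
  continuous F -> exists2 C, 0 <= C & forall p, `|p| <= B -> `|F p| <= C.
Proof.
move=> cF.
have := @closed_ball_compact R n 0 B.
have cF' : {within [set y : 'rV[R]_n | `|y - 0| <= B], continuous F} by exact: continuous_subspaceT.
move=> /(continuous_compact cF') /compact_bounded /ex_strict_bound_gt0[C C0 FC].
exists C; first exact: ltW.
by move=> p pB; apply/ltW/FC; exists p => //=; rewrite subr0.
Qed.

Lemma continuous_pair_fun (T U V : topologicalType) (f : T -> U) (g : T -> V) x :
  {for x, continuous f} -> {for x, continuous g} -> {for x, continuous (fun x => (f x, g x))}.
Proof. by move=> cf cg; exact: (@cvg_pair _ _ _ (nbhs x) (nbhs (f x)) (nbhs (g x))). Qed.

Section Frame.
Variables (R : realType) (n : nat) (G : carnot_group R n).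
Let mul := cg_mul G.
Let inv := cg_inv G.
Let dmul (v : 'rV[R]_n) (pq : 'rV[R]_n * 'rV[R]_n) : 'rV[R]_n :=
  'D_((0, v) : 'rV[R]_n * 'rV[R]_n) (fun pq : 'rV[R]_n * 'rV[R]_n => mul pq.1 pq.2) pq.

Let smooth_mul : smooth (fun pq : 'rV[R]_n * 'rV[R]_n => mul pq.1 pq.2).
Proof. by have [_ []] := cg_lie G. Qed.

Let quotient_mul v (p q : 'rV[R]_n) :
  (fun h : R => h^-1 *: (((fun pq : 'rV[R]_n * 'rV[R]_n => mul pq.1 pq.2) \o shift (p, q))
     (h *: ((0, v) : 'rV[R]_n * 'rV[R]_n)) - mul p q)) =
  (fun h => h^-1 *: ((mul p \o shift q) (h *: v) - mul p q)).
Proof. by apply: funext => h /=; rewrite scaler0 add0r. Qed.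

Lemma derivable_translation p q v : derivable (mul p) q v.
Proof.
have [_ /(_ (p, q) (0, v))] := smooth_mul [::].
by rewrite /derivable /= quotient_mul.
Qed.

Lemma derive_translation p q v : 'D_v (mul p) q = dmul v (p, q).
Proof. by rewrite /dmul /derive /= quotient_mul. Qed.

Lemma continuous_dmul v : continuous (dmul v).
Proof. by have [] := smooth_mul [:: (0, v)]. Qed.

Lemma differentiable_translation p q : differentiable (mul p) q.
Proof.
apply: C1_differentiable => [i y|i]; first exact: derivable_translation.
rewrite (_ : 'D_(basis_vec R n i) (mul p) = dmul (basis_vec R n i) \o (fun q => (p, q))); last first.
  by apply: funext => y; rewrite derive_translation.
apply: continuous_comp; last exact: continuous_dmul.
by apply: continuous_pair_fun; [exact: cst_continuous|exact: cvg_id].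
Qed.

Lemma diff_translation p q v : 'd (mul p) q v = dmul v (p, q).
Proof. by rewrite -deriveE ?derive_translation //; exact: differentiable_translation. Qed.

Lemma left_field_bounded (B : R) : exists2 C, 0 <= C &
  forall p, `|p| <= B -> forall j, `|left_field mul (basis_vec R n j) p| <= C.
Proof.
have cF j : continuous (fun p => dmul (basis_vec R n j) (p, 0)).
  rewrite (_ : (fun p => _) = dmul (basis_vec R n j) \o (fun p : 'rV[R]_n => (p, 0 : 'rV[R]_n))) //.
  move=> p; apply: continuous_comp; last exact: continuous_dmul.
  by apply: continuous_pair_fun; [exact: cvg_id|exact: cst_continuous].
have /choice[C CP] j : exists C, 0 <= C /\ forall p, `|p| <= B -> `|dmul (basis_vec R n j) (p, 0)| <= C.
  by have [C C0 CB] := continuous_bounded_ball B (cF j); exists C.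
exists (\sum_(j < n.+1) C j) => [|p pB j]; first by apply: sumr_ge0 => j _; case: (CP j).
rewrite /left_field diff_translation.
have [jn|nj] := ltnP j n.
  have jn1 : (j < n.+1)%N by rewrite ltnW.
  have [_ /(_ p pB)] := CP j; move/le_trans; apply.
  by rewrite (bigD1 (Ordinal jn1)) //= lerDl; apply: sumr_ge0 => i _; case: (CP i).
have -> : basis_vec R n j = basis_vec R n (@ord_max n).
  apply/rowP => i; rewrite !mxE.
  by rewrite (ltn_eqF (leq_trans (ltn_ord i) nj)) (ltn_eqF (ltn_ord i)).
have [_ /(_ p pB)] := CP (@ord_max n); move/le_trans; apply.
by rewrite (bigD1 ord_max) //= lerDl; apply: sumr_ge0 => i _; case: (CP i).
Qed.

(** Chain rule for the composite of the left translations by [p] and by its inverse.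
    It recovers the coordinates of a horizontal vector from the vector by a map that is
    continuous in the base point. *)
Lemma translation_diffK p v : 'd (mul (inv p)) p ('d (mul p) 0 v) = v.
Proof.
have [[gmulA gmul0l gmul0r] [gmulVl _ _ _]] := cg_lie G.
have pE : p = mul p 0 by rewrite /mul gmul0r.
have dp := differentiable_translation p 0.
have dip : differentiable (mul (inv p)) (mul p 0) by exact: differentiable_translation.
rewrite [X in 'd _ X _]pE -[LHS]/(('d (mul (inv p)) (mul p 0) \o 'd (mul p) 0) v).
rewrite -diff_comp // (_ : mul (inv p) \o mul p = id); first by rewrite diff_val.
by apply: funext => q; rewrite /= /mul gmulA gmulVl gmul0l.
Qed.

Lemma cg_dim1_le : (cg_dim G 1 <= n)%N.
Proof.
have [r0 nE _ _ _] := cg_strat G.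
rewrite {2}nE /cumdim; case: (cg_step G) r0 => // r _.
by rewrite big_nat_recl // leq_addr.
Qed.

(** The horizontal frame at [p] is the image of part of the standard basis under the
    differential at 0 of left translation by [p]; the inverse of this differential
    depends continuously on [p], hence is bounded on balls. *)
Lemma hor_comb_bounded_below (B : R) : exists2 C, 0 <= C &
  forall p, `|p| <= B -> forall u, `|u| <= C * `|hor_comb G p u|.
Proof.
have cinv : continuous inv by have [_ [_ _ _ /(_ [::])[]]] := cg_lie G.
have cF j : continuous (fun p => dmul (basis_vec R n j) (inv p, p)).
  rewrite (_ : (fun p => _) = dmul (basis_vec R n j) \o (fun p => (inv p, p))) //.
  move=> p; apply: continuous_comp; last exact: continuous_dmul.
  by apply: continuous_pair_fun; [exact: cinv|exact: cvg_id].
have /choice[C CP] j : exists C, 0 <= C /\ forall p, `|p| <= B -> `|dmul (basis_vec R n j) (inv p, p)| <= C.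
  by have [C C0 CB] := continuous_bounded_ball B (cF j); exists C.
exists (\sum_(j < n) C j) => [|p pB u]; first by apply: sumr_ge0 => j _; case: (CP j).
set w := hor_comb G p u.
pose v := \sum_(j < cg_dim G 1) u 0 j *: basis_vec R n j.
have wE : w = 'd (mul p) 0 v.
  rewrite /w /hor_comb /v linear_sum; apply: eq_bigr => j _.
  by rewrite linearZ.
have vE : v = 'd (mul (inv p)) p w by rewrite wE translation_diffK.
have uv : `|u| <= `|v|.
  apply: norm_le_coord => // j.
  have jn : (j < n)%N by apply: leq_trans cg_dim1_le.
  apply: le_trans (coord_le_norm v (Ordinal jn)).
  rewrite /v summxE (bigD1 j) //= !mxE eqxx mulr1 big1 ?addr0 // => i ij.
  rewrite !mxE /=; have -> : (j == i :> nat) = false; rewrite ?mulr0 //.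
  by apply/negbTE; rewrite eq_sym.
apply: (le_trans uv); rewrite vE {1}[w]row_sum_basis linear_sum.
apply: (le_trans (ler_norm_sum _ _ _)); rewrite mulr_suml; apply: ler_sum => j _.
rewrite linearZ normrZ mulrC ler_pM // ?coord_le_norm //.
by rewrite diff_translation; case: (CP j) => _; apply.
Qed.

Lemma hor_comb_bounded_above (B : R) : exists2 C, 0 <= C &
  forall p, `|p| <= B -> forall u, `|hor_comb G p u| <= C * `|u|.
Proof.
have [C C0 CB] := left_field_bounded B.
exists ((cg_dim G 1)%:R * C) => [|p pB u]; first by rewrite mulr_ge0.
apply: (le_trans (ler_norm_sum _ _ _)).
apply: (@le_trans _ _ (\sum_(j < cg_dim G 1) C * `|u|)).
  apply: ler_sum => j _; rewrite normrZ mulrC ler_pM // ?coord_le_norm //.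
  exact: CB.
by rewrite sumr_const card_ord -[leLHS]mulr_natl mulrA.
Qed.

End Frame.

(** * Length of absolutely continuous paths *)

(** The supremum of the points where [P] holds can only be [b], since the step crosses
    any other one. The step is asked for intervals on both sides of a point [t], as in
    Cousin's lemma. *)
Lemma real_induction (R : realType) (a b : R) (P : R -> Prop) : a <= b -> P a ->
  (forall t, a <= t <= b -> exists2 d, 0 < d & forall x y,
     a <= x -> x <= t -> t <= y -> y <= b -> t - d < x -> y < t + d -> P x -> P y) ->
  P b.
Proof.
move=> ab Pa step.
pose S := [set x | a <= x <= b /\ P x].
have Sa : S a by split; rewrite ?lexx.
have Sb x : S x -> x <= b by move=> [/andP[]].
have supS : has_sup S by split; [exists a|exists b => x /Sb].
have tab : a <= sup S <= b.
  by rewrite sup_upper_bound //= ge_sup //; exists a.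
have [d d0 dP] := step _ tab; case/andP: tab => at_ tb.
have [x [/andP[ax xb] Px] xt] := sup_adherent d0 supS.
have xS : x <= sup S by apply: sup_upper_bound => //; split => //; apply/andP.
pose y := Num.min b (sup S + d / 2).
have d2 : 0 < d / 2 by rewrite divr_gt0.
have ty : sup S <= y by rewrite le_min tb lerDl ltW.
have yb : y <= b by rewrite ge_min lexx.
have Py : P y.
  apply: (dP x y) => //; apply: (@le_lt_trans _ _ (sup S + d / 2)).
    by rewrite ge_min lexx orbT.
  by rewrite ltrD2l ltr_pdivrMr // ltr_pMr // ltr1n.
have Sy : S y by split => //; rewrite yb (le_trans at_).
have : y <= sup S by exact: sup_upper_bound.
rewrite /y ge_min => /orP[bt|]; last by rewrite gerDl leNgt d2.
by move: Py; rewrite /y min_l // (le_trans bt) // lerDl ltW.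
Qed.

Lemma derivable_approx (R : realType) (V : normedModType R) (phi : R -> V) (t e : R) :
  derivable phi t 1 -> 0 < e -> exists2 d, 0 < d &
    forall s, `|s - t| < d -> `|phi s - phi t - (s - t) *: derive1 phi t| <= e * `|s - t|.
Proof.
move=> dphi e0.
have /eqaddoP /(_ e e0) /nbhs_ballP[d /= d0 dP] := derivable_nbhs dphi.
exists d => // s sd; have := dP (s - t).
rewrite -ball_normE /= sub0r normrN => /(_ sd).
rewrite /= derive1E -[X in `|X| <= _]/(phi ((s - t) *: (1 : R) + t) - (phi t + (s - t) *: 'D_1 phi t)).
by rewrite (_ : (s - t) *: (1 : R) + t = s) ?opprD ?addrA // /GRing.scale /= mulr1 subrK.
Qed.

(** The good tags of a Cousin type argument: on every short interval around such a
    point the increment of [g] may be charged to that of [F]. Points where both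
    derivatives exist and |g'| <= F' are of this kind. *)
Definition increment_controlled (R : realType) (V : normedModType R) (a b : R) (g : R -> V)
    (F : R -> R) : set R :=
  [set t | forall e, 0 < e -> exists2 d, 0 < d & forall x y,
     a <= x -> x <= t -> t <= y -> y <= b -> t - d < x -> y < t + d ->
     `|g y - g x| <= F y - F x + e * (y - x)].

(** A Cousin type argument. The bad tags lie in an open set [U] of small measure. Real
    induction cuts the interval into pieces around good tags, charged to [F], and pieces
    inside [U], whose total contribution absolute continuity makes small. *)
Lemma abs_continuous_increment (R : realType) n (a b : R) (g : R -> 'rV[R]_n) (F : R -> R) :
  a <= b -> abs_continuous a b g ->
  (forall x y, a <= x -> x <= y -> y <= b -> F x <= F y) ->
  (@lebesgue_measure R).-negligible (`[a, b] `\` increment_controlled a b g F) ->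
  `|g b - g a| <= F b - F a.
Proof.
move=> ab acg Fmon [N [mN N0 subN]].
have le_eps (u v : R) : (forall e, 0 < e -> u <= v + e) -> u <= v by move=> h; apply/ler_addgt0Pr.
apply: le_eps => eta eta0.
pose e := eta / (b - a + 1).
have ba1 : 0 < b - a + 1 by rewrite ltr_wpDl // subr_ge0.
have e0 : 0 < e by rewrite divr_gt0.
have [d d0 acd] := acg e e0.
have Noo : (lebesgue_measure N < +oo)%E by rewrite N0 ltry.
have [U [oU NU Ud]] := lebesgue_regularity_outer mN Noo d0.
have mU : measurable U by exact: open_measurable.
have {}Ud : (lebesgue_measure U < d%:E)%E.
  apply: le_lt_trans Ud; rewrite -[leRHS]add0e -N0 -measureU ?setDIK //.
  - by rewrite setDUK.
  - exact: measurableD.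
pose A x : set (measurableTypeR R) := U `&` `[a, x]%classic.
have mA x : measurable (A x) by apply: measurableI.
have leA x y : x <= y -> (lebesgue_measure (A x) <= lebesgue_measure (A y))%E.
  move=> xy; apply: le_measure; rewrite ?inE // => t [Ut] /=.
  by rewrite in_itv /= => /andP[at_ tx]; split => //=; rewrite in_itv /= at_ (le_trans tx).
have Aoo x : (lebesgue_measure (A x) < d%:E)%E.
  by apply: le_lt_trans Ud; apply: le_measure; rewrite ?inE // => t [].
(* [m x] is the length available in [U] up to [x], a budget for the pieces around bad tags *)
pose m x := fine (lebesgue_measure (A x)).
have mE x : (lebesgue_measure (A x) = (m x)%:E)%E.
  by rewrite /m fineK // ge0_fin_numE // (lt_trans (Aoo x)) ?ltry.
have m_mono x y : x <= y -> m x <= m y by move=> xy; rewrite -lee_fin -!mE leA.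
have m_add x y : a <= x -> x <= y -> `[x, y] `<=` U -> m x + (y - x) <= m y.
  move=> ax xy xyU; rewrite -lee_fin EFinD -!mE.
  have -> : ((y - x)%:E = lebesgue_measure `]x, y]%classic)%E.
    rewrite lebesgue_measure_itv /= lte_fin; move: xy; rewrite le_eqVlt => /predU1P[->|->].
      by rewrite ltxx subrr.
    by rewrite EFinB.
  rewrite -measureU //; last first.
    apply/seteqP; split => // t [[_]]; rewrite /= !in_itv /= => /andP[_ tx] /andP[xt _].
    by have := lt_le_trans xt tx; rewrite ltxx.
  apply: le_measure; rewrite ?inE //; first exact: measurableU.
  move=> t [[Ut]|] /=; rewrite in_itv /= => /andP[h1 h2]; split => //=; rewrite ?in_itv /=.
  - by rewrite h1 (le_trans h2).
  - by apply: xyU; rewrite /= in_itv /= ltW.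
  - by rewrite h2 (le_trans ax) // ltW.
pose ok x (l : seq (R * R)) := [/\ all (fun p => (a <= p.1) && (p.1 <= p.2) && (p.2 <= x)) l,
  pairwise (fun p q => p.2 <= q.1) l & \sum_(p <- l) (p.2 - p.1) <= m x].
pose P x := exists2 l, ok x l &
  `|g x - g a| <= F x - F a + e * (x - a) + \sum_(p <- l) enorm (g p.2 - g p.1).
have Pb : P b.
  apply: (real_induction ab).
    exists [::]; first by split => //; rewrite big_nil fine_ge0.
    by rewrite big_nil !subrr normr0 mulr0 !addr0.
  move=> t tab; have [tctl|tctl] := pselect (increment_controlled a b g F t).
    have [r r0 rP] := tctl e e0; exists r => // x y ax xt ty yb rx ry [l [l1 l2 l3] lP].
    have xy : x <= y by exact: le_trans ty.
    exists l; first split => //; last first.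
      have := rP x y ax xt ty yb rx ry => h.
      rewrite -(subrK (g x) (g y)) -addrA; apply: (le_trans (ler_normD _ _)).
      apply: (le_trans (lerD h lP)); rewrite le_eqVlt; apply/orP; left; apply/eqP; ring.
    - by apply: le_trans (m_mono _ _ xy).
    - by apply: sub_all l1 => p /andP[-> /le_trans]; exact.
  have /oU[r /= r0 rU] : U t by apply: NU; apply: subN.
  exists r => // x y ax xt ty yb rx ry [l [l1 l2 l3] lP].
  have xy : x <= y by exact: le_trans ty.
  have xyU : `[x, y] `<=` U.
    move=> s; rewrite /= in_itv /= => /andP[xs sy]; apply: rU.
    by rewrite /= ltr_distlC; apply/andP; split; lra.
  exists (rcons l (x, y)); first split.
  - rewrite all_rcons /= ax xy lexx /=; apply: sub_all l1 => p /andP[-> /le_trans]; exact.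
  - rewrite -cats1 pairwise_cat l2 /= andbT allrel1r.
    by apply: sub_all l1 => p /andP[].
  - by rewrite big_rcons /=; apply: le_trans (m_add x y ax xy xyU); lra.
  rewrite big_rcons /= -(subrK (g x) (g y)) -addrA; apply: (le_trans (ler_normD _ _)).
  have h := norm_le_enorm (g y - g x); have hF := Fmon x y ax xy yb.
  have hxy : 0 <= e * (y - x) by rewrite mulr_ge0 ?subr_ge0 // ltW.
  rewrite subrK; move: lP h hF hxy; rewrite !mulrBr; lra.
have [l [l1 l2 l3] /le_trans] := Pb; apply.
have small : \sum_(p <- l) enorm (g p.2 - g p.1) <= e.
  apply/ltW; rewrite (big_nth (0, 0)) big_mkord.
  apply: (acd (size l) (fun i => (nth (0, 0) l i).1) (fun i => (nth (0, 0) l i).2)).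
  - move=> i; have /andP[/andP[]] := allP l1 _ (mem_nth (0, 0) (ltn_ord i)).
    by split.
  - move=> i j ij; have /(pairwiseP (0, 0)) pw := l2.
    have [lt|lt|e'] := ltngtP i j.
    + by left; apply: pw; rewrite ?inE.
    + by right; apply: pw; rewrite ?inE.
    + by move: ij; rewrite -val_eqE /= e' eqxx.
  - rewrite -(big_mkord xpredT (fun i => (nth (0, 0) l i).2 - (nth (0, 0) l i).1)).
    rewrite -(big_nth (0, 0) xpredT (fun p => p.2 - p.1)).
    by apply: (le_lt_trans l3); rewrite -lte_fin -mE.
have -> : eta = e * (b - a) + e by rewrite /e; field; rewrite gt_eqF.
by rewrite -!addrA lerD2l lerD2l lerD2l.
Qed.

Lemma abs_continuous_unif (R : realType) n (a b : R) (g : R -> 'rV[R]_n) (e : R) :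
  abs_continuous a b g -> 0 < e -> exists2 d, 0 < d &
    forall x y, a <= x <= b -> a <= y <= b -> `|x - y| < d -> `|g x - g y| < e.
Proof.
move=> acg e0; have [d d0 dP] := acg e e0; exists d => //.
have H x y : a <= x <= b -> a <= y <= b -> x <= y -> `|x - y| < d -> `|g x - g y| < e.
  move=> /andP[ax xb] /andP[ay yb] xy xyd.
  have := dP 1%N (fun=> x) (fun=> y); rewrite !big_ord1 => h.
  rewrite distrC; apply: le_lt_trans (norm_le_enorm _) _; apply: h.
  - by split.
  - by move=> i j; rewrite !ord1 eqxx.
  - by apply: le_lt_trans xyd; rewrite distrC ler_norm.
move=> x y xab yab xyd; have [xy|yx] := leP x y; first exact: H.
by rewrite distrC; apply: H => //; [exact: ltW|rewrite distrC].
Qed.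

(** The horizontal speed of a path involves a choice of coordinates, so comparisons are
    wanted for arbitrary nonnegative integrands. They hold because the integral is the
    supremum of the integrals of the simple functions below the integrand. *)
Lemma le_integral_dom d (T : measurableType d) (R : realType) (mu : {measure set T -> \bar R})
    (D1 D2 : set T) (f1 f2 : T -> \bar R) :
  (forall x, D1 x -> 0 <= f1 x)%E -> (forall x, D2 x -> 0 <= f2 x)%E ->
  (forall x, D1 x -> f1 x != 0%E -> D2 x /\ (f1 x <= f2 x)%E) ->
  (\int[mu]_(x in D1) f1 x <= \int[mu]_(x in D2) f2 x)%E.
Proof.
move=> f10 f20 f12; rewrite !ge0_integralE //; apply: le_ereal_sup => _ [h /= hf <-].
exists h => // x; apply: (le_trans (hf x)); rewrite /patch.
case: ifPn; rewrite ?inE ?notin_setE => D1x; last first.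
  by case: ifPn => //; rewrite inE => /f20.
have [->|f1x] := eqVneq (f1 x) 0%E.
  by case: ifPn => //; rewrite inE => /f20.
by have [D2x f12x] := f12 x D1x f1x; rewrite mem_set.
Qed.

Section PathIncrement.
Variables (R : realType) (n : nat) (a b : R) (g : R -> 'rV[R]_n).
Hypotheses (ab : a <= b) (acg : abs_continuous a b g).
Let mu := @lebesgue_measure R.

Let clamp (t : R) := Num.max a (Num.min b t).

Let clamp_itv t : a <= clamp t <= b.
Proof. by rewrite /clamp le_max lexx /= ge_max ab /= ge_min lexx. Qed.

Let clamp_id t : a <= t <= b -> clamp t = t.
Proof. by move=> /andP[at_ tb]; rewrite /clamp min_r // max_r. Qed.

Let clamp_dist s t : `|clamp s - clamp t| <= `|s - t|.
Proof.
have maxd (x y : R) : `|Num.max a x - Num.max a y| <= `|x - y|.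
  have h1 : x - y <= `|x - y| by exact: ler_norm.
  have h2 : y - x <= `|x - y| by rewrite distrC; exact: ler_norm.
  by rewrite ler_norml; case: (leP a x) => ?; case: (leP a y) => ?; apply/andP; split; lra.
apply: (le_trans (maxd _ _)).
have h1 : s - t <= `|s - t| by exact: ler_norm.
have h2 : t - s <= `|s - t| by rewrite distrC; exact: ler_norm.
by rewrite ler_norml; case: (leP b s) => ?; case: (leP b t) => ?; apply/andP; split; lra.
Qed.

Let cont_increment (c : R) : continuous (fun t => `|g (clamp (t + c)) - g (clamp t)|).
Proof.
have cont (c' : R) : continuous (fun t => g (clamp (t + c'))).
  move=> t; apply/(@cvgrPdist_lt R _ _ (nbhs t)) => e e0.
  have [d d0 dP] := abs_continuous_unif acg e0.
  apply: filterS (nbhsx_ballx t _ d0) => s; rewrite -ball_normE /= => st.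
  apply: dP => //; apply: le_lt_trans st; apply: (le_trans (clamp_dist _ _)).
  by rewrite le_eqVlt; apply/orP; left; apply/eqP; congr `| _ |; ring.
move=> t; apply: (@cvg_norm _ _ _ (nbhs t)); apply: (@cvgB _ _ _ (nbhs t)); first exact: cont.
have := cont 0 t; rewrite /continuous_at addr0.
by under eq_fun do rewrite addr0.
Qed.

(** The derivative is a limit of difference quotients, which are continuous in time
    once the path is extended by constants beyond its end points ([clamp]). *)
Lemma measurable_derive_norm (D : set (measurableTypeR R)) : measurable D ->
  (forall t, D t -> a < t < b /\ derivable g t 1) ->
  measurable_fun D (fun t => `|derive1 g t|).
Proof.
move=> mD Dg.
pose h (m : nat) (t : measurableTypeR R) : R := m.+1%:R * `|g (clamp (t + m.+1%:R^-1)) - g (clamp t)|.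
apply: (@measurable_fun_cvg _ _ _ D h).
  move=> m; apply: measurable_funM; first exact: measurable_cst.
  apply: measurable_funTS; apply: continuous_measurable_fun; exact: cont_increment.
move=> t /Dg[/andP[at_ tb] dg].
apply/cvgrPdist_le => e e0.
have [d d0 dP] := derivable_approx dg e0.
have r0 : 0 < Num.min d (b - t) by rewrite lt_min d0 subr_gt0.
near=> m.
have mr : m.+1%:R^-1 < Num.min d (b - t).
  by near: m; exact: near_infty_natSinv_lt (PosNum r0).
move: mr; rewrite lt_min => /andP[md mb].
have m0 : 0 < m.+1%:R^-1 :> R by rewrite invr_gt0.
rewrite /h -[m.+1%:R]invrK; move: (m.+1%:R^-1) md mb m0 => s md mb s0; rewrite invrK.
rewrite !clamp_id; last 2 first.
- by rewrite !ltW.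
- by apply/andP; split; lra.
have := dP (t + s); rewrite addrC addKr (gtr0_norm s0) => /(_ md).
set dgt := derive1 g t; set gd := g _ - g t => H.
rewrite -[s^-1]gtr0_norm ?invr_gt0 // -normrZ.
apply: (le_trans (ler_dist_dist _ _)).
rewrite -[X in `|X - _|](@scalerK _ _ s) ?gt_eqF // -scalerBr normrZ normfV (gtr0_norm s0) distrC.
by rewrite ler_pdivrMl // mulrC.
Unshelve. all: by end_near. Qed.

(** The function [F] of [abs_continuous_increment] is the indefinite integral of |g'|,
    whose derivative is |g'| almost everywhere by Lebesgue's differentiation theorem. *)
Lemma abs_continuous_integral_bound (C : R) (w : R -> R) : 0 < C -> (forall t, 0 <= w t) ->
  {ae mu, forall t, a <= t <= b -> derivable g t 1 /\ `|derive1 g t| <= C * w t} ->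
  ((`|g b - g a|)%:E <= C%:E * \int[mu]_(t in `[a, b]) (w t)%:E)%E.
Proof.
move=> C0 w0 [N [mN N0 subN]].
have [->|wfin] := eqVneq (\int[mu]_(t in `[a, b]) (w t)%:E)%E +oo%E.
  by rewrite gt0_muley ?lte_fin // leey.
have iw0 : (0 <= \int[mu]_(t in `[a, b]) (w t)%:E)%E by apply: integral_ge0 => *; rewrite lee_fin.
pose D : set (measurableTypeR R) := `]a, b[ `\` N.
have mD : measurable D by apply: measurableD.
have DP t : D t -> [/\ a < t < b, derivable g t 1 & `|derive1 g t| <= C * w t].
  move=> [/=]; rewrite in_itv /= => tab nNt.
  have [] : a <= t <= b -> derivable g t 1 /\ `|derive1 g t| <= C * w t.
    by apply: contrapT => h; apply: nNt; apply: subN.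
  - by case/andP: tab => /ltW -> /ltW ->.
  - by split.
pose v : measurableTypeR R -> R := (fun t => `|derive1 g t|) \_ D.
have vD t : D t -> v t = `|derive1 g t| by move=> Dt; rewrite /v patchE mem_set.
have vD0 t : ~ D t -> v t = 0 by move=> Dt; rewrite /v patchE memNset.
have v0 t : 0 <= v t.
  by have [Dt|Dt] := pselect (D t); [rewrite vD|rewrite vD0].
have mv : measurable_fun setT v.
  have Dd t : D t -> a < t < b /\ derivable g t 1 by move/DP => [].
  by have /(measurable_restrictT _ mD).1 := measurable_derive_norm mD Dd.
have vw : (\int[mu]_t (v t)%:E <= C%:E * \int[mu]_(t in `[a, b]) (w t)%:E)%E.
  have -> : (\int[mu]_t (v t)%:E = C%:E * \int[mu]_t (C^-1 * v t)%:E)%E.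
    rewrite -ge0_integralZl //.
    - by apply: eq_integral => t _; rewrite -EFinM mulVKf // gt_eqF.
    - by apply/measurable_EFinP; apply: measurable_funM => //; exact: measurable_cst.
    - by move=> t _; rewrite lee_fin mulr_ge0 // invr_ge0 ltW.
    - by rewrite lee_fin ltW.
  rewrite lee_wpmul2l ?lee_fin ?(ltW C0) //.
  apply: le_integral_dom => [t _|t _|t _]; rewrite ?lee_fin //.
    by rewrite mulr_ge0 // invr_ge0 ltW.
  have [Dt _|Dt] := pselect (D t); last by rewrite vD0 // mulr0 eqxx.
  have [/andP[at_ tb] _ gw] := DP t Dt.
  by split; [rewrite /= in_itv /= !ltW|rewrite vD // ler_pdivrMl].
have iv : mu.-integrable setT (EFin \o v).
  apply/integrableP; split; first exact/measurable_EFinP.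
  under eq_integral do rewrite /= ger0_norm //.
  apply: (le_lt_trans vw); rewrite lte_mul_pinfty ?lee_fin ?(ltW C0) //.
  by rewrite ltey.
have ivy y : mu.-integrable `]-oo, y] (EFin \o v) by apply: integrableS iv.
pose F y := (\int[mu]_(t in `]-oo, y]) v t)%R.
have FE y : (F y)%:E = (\int[mu]_(t in `]-oo, y]) (v t)%:E)%E.
  by rewrite /F /Rintegral fineK //; exact: integrable_fin_num (ivy y).
have F0 y : 0 <= F y by rewrite -lee_fin FE; apply: integral_ge0 => *; rewrite lee_fin.
have Fmono x y : x <= y -> F x <= F y.
  move=> xy; rewrite -lee_fin !FE; apply: le_integral_dom => [t _|t _|t]; rewrite ?lee_fin //.
  by rewrite /= !in_itv /= => tx _; split => //; exact: le_trans xy.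
have locv : locally_integrable setT v by apply: open_integrable_locally => //; exact: openT.
have [N' [mN' N'0 subN']] := FTC1Ny ivy locv.
have ctl : mu.-negligible (`[a, b] `\` increment_controlled a b g F).
  apply: (@negligibleS _ _ _ mu (N `|` N' `|` [set a] `|` [set b])); last first.
    apply: negligibleU; last by exists [set b]; split => //; exact: lebesgue_measure_set1.
    apply: negligibleU; last by exists [set a]; split => //; exact: lebesgue_measure_set1.
    by apply: negligibleU; [exists N; split|exists N'; split].
  move=> t [/=]; rewrite in_itv /= => /andP[at_ tb] nctl; apply: contrapT => ngood.
  have [[[nN nN'] ta] tb'] : ((~ N t /\ ~ N' t) /\ t <> a) /\ t <> b.
    by split; [split; [split|]|] => h; apply: ngood; [left; left; left|left; left; right|left; right|right].
  have Dt : D t.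
    split => //=; rewrite in_itv /= !lt_neqAle at_ tb !andbT.
    by apply/andP; split; apply/eqP => // h; apply: ta.
  have [_ dg _] := DP t Dt.
  have [dF dFE] : derivable F t 1 /\ derive1 F t = v t.
    by apply: contrapT => h; apply: nN'; apply: subN'.
  apply: nctl => e e0; have e2 : 0 < e / 2 by rewrite divr_gt0.
  have [d1 d10 d1P] := derivable_approx dg e2.
  have [d2 d20 d2P] := derivable_approx dF e2.
  exists (Num.min d1 d2); first by rewrite lt_min d10.
  have near_t s : `|s - t| < Num.min d1 d2 ->
      `|g s - g t| <= (v t + e / 2) * `|s - t| /\
      `|F s - F t - (s - t) * v t| <= e / 2 * `|s - t|.
    rewrite lt_min => /andP[/d1P h1 /d2P h2]; split; last by rewrite -dFE.
    rewrite -(subrK ((s - t) *: derive1 g t) (g s - g t)) mulrDl addrC.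
    apply: (le_trans (ler_normD _ _)); apply: lerD => //.
    by rewrite normrZ vD // mulrC.
  move=> x y ax xt ty yb dx dy.
  have dxt : `|x - t| = t - x by rewrite distrC ger0_norm // subr_ge0.
  have dyt : `|y - t| = y - t by rewrite ger0_norm // subr_ge0.
  have [] := near_t x; first by rewrite dxt; move: (Num.min _ _) dx => m; lra.
  rewrite dxt ler_norml => gx /andP[_ Fx].
  have [] := near_t y; first by rewrite dyt ltrBlDl.
  rewrite dyt ler_norml => gy /andP[Fy _].
  rewrite -(subrK (g t) (g y)) -addrA; apply: (le_trans (ler_normD _ _)).
  apply: (@le_trans _ _ ((v t + e / 2) * (y - t) + (v t + e / 2) * (t - x))).
    by apply: lerD => //; rewrite distrC.
  by move: Fx Fy; lra.
have gF := abs_continuous_increment ab acg (fun x y _ xy _ => Fmono x y xy) ctl.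
apply: le_trans vw; apply: (@le_trans _ _ (F b)%:E).
  by rewrite lee_fin; apply: (le_trans gF); rewrite gerBl.
by rewrite FE; apply: le_integral_dom => [t _|t _|t _ _]; rewrite ?lee_fin.
Qed.

End PathIncrement.

(** * The Carnot-Caratheodory distance dominates the Euclidean one *)

Section LowerBound.
Variables (R : realType) (n : nat) (G : carnot_group R n).

Lemma hor_coordK p v : horizontal_space G p v -> hor_comb G p (hor_coord G p v) = v.
Proof.
move=> [u _ uv]; apply: (@xgetPex _ 0 [set u | hor_comb G p u = v]).
by exists u.
Qed.

Lemma hor_norm_ge0 p v : 0 <= hor_norm G p v.
Proof. exact: sqrtr_ge0. Qed.

Lemma abs_continuousS (a b s : R) (g : R -> 'rV[R]_n) :
  s <= b -> abs_continuous a b g -> abs_continuous a s g.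
Proof.
move=> sb acg e /acg[d d0 dP]; exists d => // N u v uv; apply: dP => i.
by have [? ? vs] := uv i; split => //; exact: le_trans sb.
Qed.

(** As long as the path stays in the unit ball around [p] its Euclidean speed is at most
    [C] times its horizontal speed. A path too short to leave this ball stays in it, by
    real induction. *)
Lemma path_length_ge (p q : 'rV[R]_n) (B C l a b : R) (g : R -> 'rV[R]_n) :
  0 < C -> (forall x, `|x| <= B + 1 -> forall u, `|hor_comb G x u| <= C * `|u|) ->
  `|p| <= B -> a <= b -> horizontal_path G a b g -> g a = p -> g b = q ->
  path_length G a b g = l%:E -> C * l < 1 -> `|q - p| <= C * l.
Proof.
move=> C0 CP pB ab [acg [N [mN N0 subN]]] ga gb lenE l1.
have l0 : 0 <= l by rewrite -lee_fin -lenE; apply: integral_ge0 => t _; rewrite lee_fin hor_norm_ge0.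
pose P x := forall s, a <= s <= x -> `|g s - p| <= C * l.
have Cl0 : 0 <= C * l by rewrite mulr_ge0 // ltW.
suff Pb : P b by rewrite -gb; apply: Pb; rewrite ab lexx.
apply: (real_induction ab).
  by move=> s /andP[as_ sa]; rewrite (_ : s = a) ?ga ?subrr ?normr0 //; apply/eqP; rewrite eq_le sa as_.
move=> t tab.
(* within this distance of [g t] the path cannot leave the unit ball *)
have eta0 : 0 < (1 - C * l) / 2 by rewrite divr_gt0 // subr_gt0.
have [d d0 dP] := abs_continuous_unif acg eta0.
exists d => // x y ax xt ty yb dx dy Px.
have tight s : a <= s <= y -> `|g s - p| <= 1.
  move=> /andP[as_ sy]; have [sx|xs] := leP s x.
    by apply: le_trans (ltW l1); apply: Px; rewrite as_.
  have gx : `|g x - p| <= C * l by apply: Px; rewrite ax lexx.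
  have gxt : `|g x - g t| < (1 - C * l) / 2.
    apply: dP => //; first by rewrite ax (le_trans xt) //; case/andP: tab.
    by rewrite ler0_norm ?subr_le0 // opprB; lra.
  have gst : `|g s - g t| < (1 - C * l) / 2.
    apply: dP => //; first by rewrite as_ (le_trans sy).
    by rewrite ltr_norml; apply/andP; split; lra.
  rewrite (_ : g s - p = (g s - g t) + ((g t - g x) + (g x - p))); last first.
    by rewrite !addrA !subrK.
  apply: (le_trans (ler_normD _ _)).
  have := ler_normD (g t - g x) (g x - p); move: gxt; rewrite distrC; lra.
move=> s /andP[as_ sy].
have sb : s <= b by exact: le_trans yb.
rewrite -ga -lee_fin EFinM -lenE.
apply: le_trans (_ : C%:E * \int[@lebesgue_measure R]_(t in `[a, s])
    (hor_norm G (g t) (derive1 g t))%:E <= _)%E; last first.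
  rewrite lee_wpmul2l ?lee_fin ?(ltW C0) //.
  apply: le_integral_dom => [u _|u _|u]; rewrite ?lee_fin ?hor_norm_ge0 //.
  by rewrite /= !in_itv /= => /andP[-> us] _; split => //; exact: le_trans sb.
apply: (abs_continuous_integral_bound as_ (abs_continuousS sb acg) C0).
  by move=> u; exact: hor_norm_ge0.
exists N; split => // u /= nu; apply: subN => /= hu; apply: nu => /andP[au us].
have [|dgu hgu] := hu; first by rewrite au (le_trans us).
split => //; rewrite -[X in `|X| <= _](hor_coordK hgu).
apply: (@le_trans _ _ (C * `|hor_coord G (g u) (derive1 g u)|)).
  apply: CP; rewrite -(subrK p (g u)) (le_trans (ler_normD _ _)) // addrC lerD //.
  by apply: tight; rewrite au (le_trans us).
by rewrite ler_wpM2l ?(ltW C0) // norm_le_enorm.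
Qed.

(** Only paths of length less than [e] matter for a distance less than [e], and
    [path_length_ge] applies to these. *)
Lemma dcc_locally_dominates (B : R) : exists2 e, 0 < e & exists2 C, 0 <= C &
  forall p q, `|p| <= B -> (dcc G p q < e%:E)%E -> ((`|p - q|)%:E <= C%:E * dcc G p q)%E.
Proof.
have [C0 C00 C0P] := hor_comb_bounded_above G (B + 1).
pose C := C0 + 1.
have Cgt0 : 0 < C by rewrite ltr_wpDl.
have CP x : `|x| <= B + 1 -> forall u, `|hor_comb G x u| <= C * `|u|.
  by move=> xB u; apply: (le_trans (C0P x xB u)); rewrite ler_wpM2r // lerDl.
exists C^-1; first by rewrite invr_gt0.
exists C; first exact: ltW.
move=> p q pB de.
have key l : [set l | exists (a b : R) (g : R -> 'rV[R]_n), [/\ a <= b, horizontal_path G a b g,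
    g a = p, g b = q & l = path_length G a b g]] l -> (l < (C^-1)%:E)%E -> ((`|q - p| / C)%:E <= l)%E.
  move=> [a [b [g [ab hg ga gb ->]]]] lt.
  have len0 : (0 <= path_length G a b g)%E.
    by apply: integral_ge0 => t _; rewrite lee_fin hor_norm_ge0.
  have lenE : path_length G a b g = (fine (path_length G a b g))%:E.
    by rewrite fineK // ge0_fin_numE // (lt_trans lt) ?ltry.
  rewrite lenE lee_fin ler_pdivrMr // mulrC.
  apply: (path_length_ge Cgt0 CP pB ab hg ga gb lenE).
  by move: lt; rewrite lenE lte_fin -(ltr_pM2l Cgt0) divff // gt_eqF.
have [l0 Sl0 l0C] := ereal_inf_lt de.
have qp : ((`|q - p| / C)%:E < (C^-1)%:E)%E by exact: le_lt_trans (key _ Sl0 l0C) l0C.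
have : ((`|q - p| / C)%:E <= dcc G p q)%E.
  apply: le_ereal_inf_tmp => l Sl; have [lt|ge] := ltP l ((C^-1)%:E)%E; first exact: key.
  by apply: le_trans ge; exact: ltW.
rewrite distrC => h; apply: le_trans (lee_wpmul2l _ h); last by rewrite lee_fin ltW.
by rewrite -EFinM lee_fin mulrC divfK // gt_eqF.
Qed.

End LowerBound.

(** * Weakly contact maps are Lipschitz for the Carnot-Caratheodory distance *)

Section AlmostEverywhereBound.
Import HBNNSimple.

(** A simple function below the integrand may be cut off on the exceptional null set.
    The maximum with 0 accounts for a degenerate interval, where the bound by [M]
    carries no information. *)
Lemma integral_le_ae_bound (R : realType) (a b M : R) (w : R -> R) : a <= b ->
  (forall t, 0 <= w t) ->
  {ae @lebesgue_measure R, forall t, a <= t <= b -> w t <= M} ->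
  (\int[@lebesgue_measure R]_(t in `[a, b]) (w t)%:E <= (Num.max 0 M * (b - a))%:E)%E.
Proof.
move=> ab w0 [N [mN N0 subN]].
rewrite ge0_integralE; last by move=> t _; rewrite lee_fin.
apply: ge_ereal_sup => _ [h /= hw <-].
have h0 t : 0 <= h t by exact: fun_ge0.
have -> : sintegral (@lebesgue_measure R) h = (\int[@lebesgue_measure R]_t (h t)%:E)%E.
  by rewrite integral_nnsfun //; congr sintegral; apply: funext => t; rewrite patchT // inE.
rewrite (ge0_negligible_integral mN) //; last 2 first.
- exact/measurable_EFinP.
- by move=> t _; rewrite lee_fin.
apply: (@le_trans _ _ (\int[@lebesgue_measure R]_(t in `[a, b]) (Num.max 0 M)%:E)%E).
  apply: le_integral_dom => [t _|t _|t [_ Nt]].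
  - by rewrite lee_fin.
  - by rewrite lee_fin le_max lexx.
  move=> ht0; have := hw t; rewrite patchE; case: ifPn => [|_].
    rewrite inE => tab ht; split => //; apply: (le_trans ht); rewrite lee_fin le_max.
    apply/orP; right; move: tab; rewrite /= in_itv /=.
    by apply: contrapT => h'; apply: Nt; apply: subN.
  rewrite lee_fin => ht; exfalso; move/eqP: ht0; apply; congr EFin.
  by apply/eqP; rewrite eq_le ht h0.
rewrite integral_cst //= lebesgue_measure_itv /= lte_fin EFinM.
move: ab; rewrite le_eqVlt => /predU1P[->|ab]; first by rewrite ltxx subrr.
by rewrite ab EFinB.
Qed.

End AlmostEverywhereBound.

Lemma lipschitz_derive_bound (R : realType) (V : normedModType R) (g : R -> V) (t K d0 : R) :
  derivable g t 1 -> 0 < d0 ->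
  (forall s, `|s - t| < d0 -> `|g s - g t| <= K * `|s - t|) -> `|derive1 g t| <= K.
Proof.
move=> dg d00 gK; apply/ler_addgt0Pr => e e0.
have [d d_0 dP] := derivable_approx dg e0.
pose h := Num.min d d0 / 2.
have m0 : 0 < Num.min d d0 by rewrite lt_min d_0.
have h0 : 0 < h by rewrite divr_gt0.
have hm : h < Num.min d d0 by rewrite ltr_pdivrMr // ltr_pMr // ltr1n.
have hE : t + h - t = h by rewrite addrC addKr.
have nh : `|t + h - t| = h by rewrite hE gtr0_norm.
move: hm; rewrite lt_min => /andP[hd hd0].
have := dP (t + h); rewrite nh hE => /(_ hd) H1.
have := gK (t + h); rewrite nh => /(_ hd0) H2.
have : h * `|derive1 g t| <= h * (K + e).
  rewrite -{1}(gtr0_norm h0) -normrZ -(subrK (g (t + h) - g t) (h *: derive1 g t)).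
  apply: (le_trans (ler_normD _ _)); rewrite distrC.
  by move: H1 H2; rewrite mulrDr (mulrC h) (mulrC h); lra.
by rewrite ler_pM2l.
Qed.

Lemma lipschitz_abs_continuous (R : realType) n (a b K : R) (g : R -> 'rV[R]_n) :
  0 <= K -> (forall s t, a <= s <= b -> a <= t <= b -> `|g s - g t| <= K * `|s - t|) ->
  abs_continuous a b g.
Proof.
move=> K0 gK e e0.
pose c := n%:R * K + 1.
have c0 : 0 < c by rewrite ltr_wpDl // mulr_ge0.
exists (e / c) => [|N s t st _]; first by rewrite divr_gt0.
rewrite ltr_pdivlMr // => lt; apply: le_lt_trans lt.
rewrite mulr_suml; apply: ler_sum => i _; have [as_ ts tb] := st i.
have sab : a <= s i <= b by rewrite as_ (le_trans ts).
have tab : a <= t i <= b by rewrite tb (le_trans as_).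
apply: (le_trans (enorm_le_norm _)).
apply: (@le_trans _ _ (n%:R * (K * `|t i - s i|))); first by rewrite ler_wpM2l // gK.
rewrite ger0_norm ?subr_ge0 // mulrA mulrC ler_wpM2l ?subr_ge0 //.
by rewrite lerDl.
Qed.

Section UpperBound.
Variables (R : realType) (k n : nat) (G : carnot_group R n).
Variables (f : 'rV[R]_k -> 'rV[R]_n) (x0 : 'rV[R]_k) (rho L : R) (N : set 'rV[R]_k).
Hypotheses (k_gt0 : (0 < k)%N) (rho0 : 0 < rho) (L0 : 0 <= L).
Hypothesis fL : forall x y, `|x - x0| < rho -> `|y - x0| < rho -> `|f x - f y| <= L * `|x - y|.
Hypothesis Nnull : null_cover (@supdist R k) k N.
Hypothesis fN : forall x, `|x - x0| < rho -> ~ N x ->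
  differentiable f x /\ range ('d f x) `<=` horizontal_space G (f x).

(** Chain rule along a segment that avoids [N] at time [t]. The path is only compared
    with the segment near [t], for use on each piece of a broken line. *)
Lemma horizontal_segment (y v : 'rV[R]_k) (K t d : R) (g : R -> 'rV[R]_n) :
  `|v| <= K -> `|y + t *: v - x0| < rho -> ~ N (y + t *: v) -> 0 < d ->
  (forall s, `|s - t| < d -> g s = f (y + s *: v)) ->
  [/\ derivable g t 1, horizontal_space G (g t) (derive1 g t) & `|derive1 g t| <= L * K].
Proof.
move=> vK yt Nyt d0 gE.
have [df dfH] := fN yt Nyt.
have gt : g t = f (y + t *: v) by rewrite gE // subrr normr0.
have dg : is_derive t (1 : R) g ('D_v f (y + t *: v)).
  apply: near_eq_is_derive (is_derive_line _); last exact: diff_derivable.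
  apply: filterS (nbhsx_ballx t _ d0) => s; rewrite -ball_normE /= => st.
  by rewrite gE // distrC.
have dgE : derive1 g t = 'd f (y + t *: v) v.
  by rewrite derive1E derive_val deriveE.
have dg1 : derivable g t 1 by [].
split => //.
  by rewrite dgE gt; apply: dfH; exists v.
have K0 : 0 <= K by exact: le_trans vK.
pose d' := (rho - `|y + t *: v - x0|) / (K + 1).
have K1 : 0 < K + 1 by rewrite ltr_wpDl.
have d'0 : 0 < d' by rewrite divr_gt0 // subr_gt0.
apply: (@lipschitz_derive_bound _ _ _ _ _ (Num.min d d') dg1); first by rewrite lt_min d0.
move=> s; rewrite lt_min => /andP[sd sd'].
have E : y + s *: v - (y + t *: v) = (s - t) *: v.
  by rewrite opprD addrACA subrr add0r scalerBl.
have nE : `|y + s *: v - (y + t *: v)| <= K * `|s - t|.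
  by rewrite E normrZ mulrC ler_wpM2r.
rewrite gE // gt -mulrA.
apply: (le_trans (fL _ yt)); last by rewrite ler_wpM2l.
rewrite -(subrK (y + t *: v) (y + s *: v)) -addrA.
apply: (le_lt_trans (ler_normD _ _)); rewrite -ltrBrDr; apply: (le_lt_trans nE).
move: sd'; rewrite ltr_pdivlMr // => sd'; apply: le_lt_trans sd'.
by rewrite mulrC ler_wpM2l // lerDl.
Qed.

(** A broken line given by [generic_broken_line] is mapped by [f] to a horizontal path
    whose Euclidean speed is at most [L] times that of the line, and whose length is
    therefore bounded through [hor_comb_bounded_below]. *)
Lemma dcc_lipschitz : exists2 C, 0 <= C & forall x x',
  `|x - x0| <= rho / 8 -> `|x' - x0| <= rho / 8 -> (dcc G (f x) (f x') <= (C * `|x - x'|)%:E)%E.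
Proof.
pose B := `|f x0| + L * rho.
have fB x : `|x - x0| < rho -> `|f x| <= B.
  move=> xr; rewrite -(subrK (f x0) (f x)) addrC (le_trans (ler_normD _ _)) // lerD2l.
  have x00 : `|x0 - x0| < rho by rewrite subrr normr0.
  by apply: (le_trans (fL xr x00)); rewrite ler_wpM2l // ltW.
have [C1 C10 C1P] := hor_comb_bounded_below G B.
pose C := (cg_dim G 1)%:R * (C1 * (L * 2)) * 2.
have C0 : 0 <= C by rewrite !mulr_ge0.
exists C => // x x' xr xr'.
have [<-|xx'] := eqVneq x x'.
  rewrite subrr normr0 mulr0; apply: ereal_inf_lbound.
  exists 0, 0, (fun=> f x); split => //; first split.
  - apply: (@lipschitz_abs_continuous _ _ _ _ 0) => // s t _ _.
    by rewrite subrr normr0 mul0r.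
  - exists [set 0]; split => //; first exact: lebesgue_measure_set1.
    move=> t /= ht; apply: contrapT => t0; apply: ht => /andP[h1 h2].
    by exfalso; apply: t0; apply/eqP; rewrite eq_le h1 h2.
  - apply/esym; rewrite /path_length set_itv1; apply: integral_Sset1; exact: subset_refl.
pose r := `|x - x'|.
have r0 : 0 < r by rewrite normr_gt0 subr_eq0.
have rr : r <= rho / 4.
  rewrite /r -(subrK x0 x) -addrA (le_trans (ler_normD _ _)) // [`|x0 - _|]distrC; lra.
have [y [yx yx' neg neg']] := generic_broken_line k_gt0 Nnull r0 (lexx r).
(* a broken line on the time interval [[0, 2]]; starting within [rho / 8] of the centre and
   with vertex [y] at distance at most [rho / 2] of its ends, it stays in the ball of radius
   [rho] *)
pose c t : 'rV[R]_k := if t <= 1 then x + t *: (y - x) else x' + (2 - t) *: (y - x').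
pose g t := f (c t).
have cE t : 1 <= t -> c t = x' + (2 - t) *: (y - x').
  rewrite le_eqVlt => /predU1P[<-|t1]; rewrite /c ?lexx; last by rewrite leNgt t1.
  by rewrite (_ : 2 - 1 = 1 :> R) ?scale1r ?subrKC //; ring.
have c1 t : t <= 1 -> c t = x + t *: (y - x) by rewrite /c => ->.
have cdist s t : s <= t -> `|c s - c t| <= 2 * r * (t - s).
  have below u v : u <= v -> v <= 1 -> `|c u - c v| <= 2 * r * (v - u).
    move=> uv v1; rewrite !c1 ?(le_trans uv) // opprD addrACA subrr add0r -scalerBl normrZ.
    by rewrite distrC ger0_norm ?subr_ge0 // mulrC ler_wpM2r // subr_ge0.
  have above u v : u <= v -> 1 <= u -> `|c u - c v| <= 2 * r * (v - u).
    move=> uv u1; rewrite !cE ?(le_trans u1) // opprD addrACA subrr add0r -scalerBl normrZ.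
    rewrite (_ : 2 - u - (2 - v) = v - u); last by ring.
    by rewrite ger0_norm ?subr_ge0 // mulrC ler_wpM2r // subr_ge0.
  move=> st; have [t1|t1] := leP t 1; first exact: below.
  have [s1|s1] := leP s 1; last by apply: above => //; exact: ltW.
  rewrite -(subrK (c 1) (c s)) -addrA; apply: (le_trans (ler_normD _ _)).
  have := below s 1 s1 (lexx 1); have := above 1 t (ltW t1) (lexx 1); lra.
have cdist' s t : `|c s - c t| <= 2 * r * `|s - t|.
  have [st|ts] := leP s t.
    by rewrite [`|s - t|]distrC ger0_norm ?subr_ge0 // cdist.
  by rewrite distrC ger0_norm ?subr_ge0 ?(ltW ts) // cdist // ltW.
have cball t : 0 <= t <= 2 -> `|c t - x0| < rho.
  move=> /andP[t0 t2]; have [t1|t1] := leP t 1.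
    rewrite c1 // addrAC (le_lt_trans (ler_normD _ _)) // normrZ (ger0_norm t0).
    have : t * `|y - x| <= 1 * (2 * r) by apply: ler_pM.
    lra.
  rewrite cE ?(ltW t1) //.
  rewrite addrAC (le_lt_trans (ler_normD _ _)) // normrZ ger0_norm ?subr_ge0 //.
  have : (2 - t) * `|y - x'| <= 1 * (2 * r) by apply: ler_pM => //; lra.
  lra.
have c0 : c 0 = x by rewrite c1 // scale0r addr0.
have c2 : c 2 = x' by rewrite cE ?ler1n // subrr scale0r addr0.
have gP : {ae @lebesgue_measure R, forall t, 0 <= t <= 2 -> [/\ derivable g t 1,
    horizontal_space G (g t) (derive1 g t) & `|derive1 g t| <= L * (2 * r)]}.
  have neg1 (z : R) : (@lebesgue_measure R).-negligible [set z].
    by exists [set z]; split => //; exact: lebesgue_measure_set1.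
  apply: negligibleS (negligibleU (negligibleU neg neg') (negligibleU (negligibleU (neg1 0) (neg1 1)) (neg1 2))).
  move=> t /= ht; apply: contrapT => nt; apply: ht => /andP[t0 t2].
  have t00 : 0 < t by rewrite lt_neqAle t0 andbT; apply/eqP => h; apply: nt; right; left; left.
  have t22 : t < 2 by rewrite lt_neqAle t2 andbT; apply/eqP => h; apply: nt; right; right.
  have [t1|t1|t1] := ltgtP t 1; last by exfalso; apply: nt; right; left; right.
    apply: (@horizontal_segment x (y - x) _ t (1 - t)) => //.
    - by rewrite -c1 ?(ltW t1) //; apply: cball; rewrite t0.
    - by move=> Nt; apply: nt; left; left; rewrite t00 ltW.
    - by rewrite subr_gt0.
    - move=> s; rewrite ltr_norml => /andP[_ s1]; rewrite /g c1 //; lra.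
  have lineE s : x' + (2 - s) *: (y - x') = x' + 2 *: (y - x') + s *: (x' - y).
    by rewrite scalerBl -addrA -scalerN opprB.
  apply: (@horizontal_segment (x' + 2 *: (y - x')) (x' - y) _ t (t - 1)) => //.
  - by rewrite distrC.
  - by rewrite -lineE -cE ?(ltW t1) //; apply: cball; rewrite t0.
  - by rewrite -lineE => Nt; apply: nt; left; right; rewrite t22 ltW.
  - by rewrite subr_gt0.
  - move=> s; rewrite ltr_norml => /andP[s1 _]; rewrite /g cE ?lineE //; lra.
apply: (@le_trans _ _ (path_length G 0 2 g)).
  apply: ereal_inf_lbound; exists 0, 2, g; split => //.
  - split; first apply: (@lipschitz_abs_continuous _ _ _ _ (L * (2 * r))).
    + by rewrite !mulr_ge0 // ltW.
    + move=> s t s02 t02; apply: (le_trans (fL (cball s s02) (cball t t02))).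
      by rewrite -mulrA ler_wpM2l // mulrA.
    + by apply: negligibleS gP => t /=; apply: contra_not => + t02 => /(_ t02)[].
  - by rewrite /g c0.
  - by rewrite /g c2.
have bound : {ae @lebesgue_measure R, forall t, 0 <= t <= 2 ->
    hor_norm G (g t) (derive1 g t) <= (cg_dim G 1)%:R * (C1 * (L * (2 * r)))}.
  apply: negligibleS gP => t /=; apply: contra_not => + t02 => /(_ t02)[_ gH gL].
  apply: (le_trans (enorm_le_norm _)); rewrite ler_wpM2l //.
  apply: (le_trans (C1P (g t) _ _)); first exact/fB/cball.
  by rewrite hor_coordK // ler_wpM2l.
apply: (le_trans (integral_le_ae_bound (ler0n _ _) (fun t => hor_norm_ge0 _ _ _) bound)).
rewrite lee_fin max_r ?mulr_ge0 // ?(ltW r0) // subr0 /C.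
by rewrite le_eqVlt; apply/orP; left; apply/eqP; rewrite /r; ring.
Qed.

End UpperBound.

(** * Injective images of a cube are not null *)

Section SetDist.
Variables (R : realType) (V : normedModType R) (K : set V).
Hypothesis K0 : K !=set0.

Definition setdist (z : V) : R := inf [set `|z - y| | y in K].

Lemma setdist_has_inf z : has_inf [set `|z - y| | y in K].
Proof.
have [y Ky] := K0; split; first by exists `|z - y|; exists y.
by exists 0 => _ [u _ <-].
Qed.

Lemma setdist_le z y : K y -> setdist z <= `|z - y|.
Proof. by move=> Ky; apply: ge_inf; [case: (setdist_has_inf z)|exists y]. Qed.

Lemma le_setdist z d : (forall y, K y -> d <= `|z - y|) -> d <= setdist z.
Proof.
move=> h; apply: lb_le_inf; first by case: (setdist_has_inf z).
by move=> _ [y Ky <-]; exact: h.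
Qed.

(** Distance functions turn the separation of two sets into a Lipschitz function on
    the whole space, which spares an extension theorem. *)
Lemma setdist_lipschitz z z' : `|setdist z - setdist z'| <= `|z - z'|.
Proof.
have H u v : setdist u <= setdist v + `|u - v|.
  rewrite -lerBlDr; apply: le_setdist => y Ky; rewrite lerBlDr.
  apply: (le_trans (setdist_le _ Ky)).
  by rewrite -(subrK v u) -addrA addrC (le_trans (ler_normD _ _)) // subrK.
rewrite ler_norml; apply/andP; split; first by have := H z' z; rewrite distrC; lra.
by have := H z z'; lra.
Qed.

End SetDist.

(** Otherwise the rescaled set would fill the unit cube, and some line would meet it in
    a set containing the unit interval. *)
Lemma null_cover_avoid (R : realType) k (M : set 'rV[R]_k) (d : R) : (0 < k)%N -> 0 < d ->
  null_cover (@supdist R k) k M -> exists2 c, `|c| <= d & ~ M c.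
Proof.
move=> k0 d0 Mn; pose i0 := Ordinal k0.
have Mn' : null_cover (@supdist R k) k ((fun m => d^-1 *: m) @` M).
  apply: (@null_cover_image _ _ _ (@supdist R k) _ _ _ _ 1 d^-1) => //.
    by rewrite invr_ge0 ltW.
  by move=> x y _ _ _; rewrite /supdist -scalerBr normrZ gtr0_norm ?invr_gt0.
have [p [p01 negp]] := null_slice i0 Mn'.
have [t t01 Mt] : exists2 t, 0 <= t <= 1 & ~ (((fun m => d^-1 *: m) @` M) (set_coord p i0 t)).
  apply: contrapT => nex.
  have : (@lebesgue_measure R).-negligible `[0, 1]%classic.
    apply: negligibleS negp => t /=; rewrite in_itv /= => t01.
    by apply: contrapT => h; apply: nex; exists t.
  have m01 : measurable (`[0, 1]%classic : set (measurableTypeR R)) by [].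
  have := @lebesgue_measure_itv R `[0, 1]%R; rewrite /= lte_fin ltr01 oppr0 adde0.
  by move=> mu01 /(negligibleP _ m01)/eqP; rewrite [X in X == _]mu01 onee_eq0.
exists (d *: set_coord p i0 t).
  rewrite normrZ gtr0_norm // ger_pMr //; apply: norm_le_coord => // j; rewrite mxE.
  case: ifP => _; first by rewrite ger0_norm; case/andP: t01.
  by have /andP[p0 p1] := p01 j; rewrite ger0_norm.
move=> Mc; apply: Mt; exists (d *: set_coord p i0 t) => //.
by rewrite scalerK // gt_eqF.
Qed.

Lemma null_cover_dist (R : realType) (T : Type) (d d' : T -> T -> \bar R) k (M : set T) (e C : R) :
  (0 < k)%N -> 0 < e -> 0 <= C ->
  (forall x y, M x -> M y -> (d x y < e%:E)%E -> (d' x y <= C%:E * d x y)%E) ->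
  null_cover d k M -> null_cover d' k M.
Proof.
by move=> k0 e0 C0 h /(null_cover_image k0 e0 C0 h (f := id)); rewrite image_id.
Qed.

(** Poincare-Miranda theorem, up to an error [e]. On a fine grid label a vertex in
    direction [i] by whether the i-th coordinate of [H] exceeds that of [c]. In a simplex
    along whose edges every label changes, the coordinates of [H - c] are small. *)
Lemma miranda_approx (R : realType) k (x0 : 'rV[R]_k) (sigma L : R)
    (H : 'rV[R]_k -> 'rV[R]_k) (c : 'rV[R]_k) :
  0 < sigma -> 0 <= L ->
  let Q := [set x : 'rV[R]_k | `|x - x0| <= sigma] in
  (forall x y, Q x -> Q y -> `|H x - H y| <= L * `|x - y|) ->
  (forall i x, Q x -> x 0 i = x0 0 i - sigma -> H x 0 i <= c 0 i) ->
  (forall i x, Q x -> x 0 i = x0 0 i + sigma -> c 0 i < H x 0 i) ->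
  forall e, 0 < e -> exists2 x, Q x & `|H x - c| <= e.
Proof.
move=> s0 L0 Q HL Hm Hp e e0.
(* a mesh [2 * sigma / N.+1] so small that [H] moves by at most [e] within a simplex *)
pose N := Num.truncn (2 * sigma * L / e).
have Ne : 2 * sigma * L / N.+1%:R <= e.
  by rewrite ler_pdivrMr ?ltr0Sn // [e * _]mulrC -ler_pdivrMr //; exact/ltW/truncnS_gt.
(* labels live on all integer points, which are clamped to the grid *)
pose pt (v : 'I_k -> nat) : 'rV[R]_k :=
  \row_i (x0 0 i - sigma + 2 * sigma * (minn (v i) N.+1)%:R / N.+1%:R).
have N0 : 0 < N.+1%:R :> R by rewrite ltr0Sn.
have Qpt v : Q (pt v).
  rewrite /Q /=; apply: norm_le_coord => [|j]; first exact: ltW.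
  have h0 : 0 <= (minn (v j) N.+1)%:R / N.+1%:R :> R by rewrite divr_ge0.
  have h1 : (minn (v j) N.+1)%:R / N.+1%:R <= 1 :> R.
    by rewrite ler_pdivrMr // mul1r ler_nat geq_minr.
  rewrite !mxE -mulrA; move: (_ / _) h0 h1 => q h0 h1.
  by rewrite ler_norml; apply/andP; split; nra.
have pt0 i v : v i = 0%N -> pt v 0 i = x0 0 i - sigma.
  by move=> vi; rewrite mxE vi min0n mulr0 mul0r addr0.
have ptN i v : v i = N.+1 -> pt v 0 i = x0 0 i + sigma.
  by move=> vi; rewrite mxE vi minnn; rewrite mulfK ?gt_eqF //; ring.
have [v [s vs]] : exists v s, forall j : 'I_k,
    (c 0 j < H (pt (@vertex k N v s j.+1)) 0 j) != (c 0 j < H (pt (@vertex k N v s j)) 0 j).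
  apply: (@kuhn_cube k N (fun i x => c 0 i < H (pt x) 0 i)) => i x xi.
    by apply/negbTE; rewrite -leNgt; apply: Hm => //; exact: pt0.
  by apply: Hp => //; exact: ptN.
exists (pt (vertex v s 0)); first exact: Qpt.
have close l : `|pt (vertex v s 0) - pt (vertex v s l)| <= 2 * sigma / N.+1%:R.
  apply: norm_le_coord => [|j]; first by rewrite divr_ge0 // mulr_ge0 // ltW.
  rewrite !mxE /vertex ltn0 addn0.
  have -> : forall u p q : R, u + 2 * sigma * p / N.+1%:R - (u + 2 * sigma * q / N.+1%:R) =
      2 * sigma / N.+1%:R * (p - q) by move=> *; ring.
  rewrite normrM ger0_norm ?divr_ge0 ?mulr_ge0 ?(ltW s0) // ler_piMr ?divr_ge0 ?mulr_ge0 ?(ltW s0) //.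
  have /orP[/eqP ->|/eqP ->] : (minn (v j + (s j < l)) N.+1 == minn (v j) N.+1)
      || (minn (v j + (s j < l)) N.+1 == (minn (v j) N.+1).+1).
  - by case: (s j < l)%N; lia.
  - by rewrite subrr normr0.
  - by rewrite -natr1 opprD addrA subrr add0r normrN normr1.
apply: norm_le_coord => [|j]; first exact: ltW.
have Hclose l : `|H (pt (vertex v s 0)) 0 j - H (pt (vertex v s l)) 0 j| <= e.
  apply: le_trans Ne; apply: (@le_trans _ _ (L * (2 * sigma / N.+1%:R))).
    apply: le_trans (ler_wpM2l L0 (close l)); apply: le_trans (HL _ _ (Qpt _) (Qpt _)).
    by apply: le_trans (coord_le_norm _ j); rewrite !mxE.
  by rewrite le_eqVlt; apply/orP; left; apply/eqP; ring.
have := vs j; have := Hclose j; have := Hclose j.+1; rewrite !ler_norml !mxE.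
move=> /andP[a1 a2] /andP[b1 b2].
case: ltP => h1; case: ltP => h2 // _; apply/andP; split; lra.
Qed.

Lemma lipschitz_within_continuous (R : realType) (V W : normedModType R) (A : set V)
    (f : V -> W) (L : R) : 0 <= L ->
  (forall x y, A x -> A y -> `|f x - f y| <= L * `|x - y|) -> {within A, continuous f}.
Proof.
move=> L0 fL; apply/subspace_continuousP => x Ax.
apply/(@cvgrPdist_le _ _ _ (within A (nbhs x))) => e e0.
have d0 : 0 < e / (L + 1) by rewrite divr_gt0 // ltr_wpDl.
apply: filterS (nbhsx_ballx x _ d0) => y; rewrite -ball_normE /= => /ltW xy Ay.
apply: (le_trans (fL x y Ax Ay)).
move: xy; rewrite ler_pdivlMr ?ltr_wpDl // => xy; apply: le_trans xy.
by rewrite mulrC ler_wpM2l // lerDl.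
Qed.

Lemma compact_sets_separated (R : realType) n (K1 K2 : set 'rV[R]_n) :
  compact K1 -> compact K2 -> K1 !=set0 -> K2 !=set0 -> (forall z, K1 z -> ~ K2 z) ->
  exists2 d : R, 0 < d & forall x y, K1 x -> K2 y -> d <= `|x - y|.
Proof.
move=> c1 c2 [a Ka] [b Kb] disj.
have cont : continuous (fun p : 'rV[R]_n * 'rV[R]_n => `|p.1 - p.2|).
  move=> p; apply: (@cvg_norm _ _ _ (nbhs p)); apply: (@cvgB _ _ _ (nbhs p)).
    exact: cvg_fst.
  exact: cvg_snd.
have ne : K1 `*` K2 !=set0 by exists (a, b).
have [[x y]] := compact_EVT_min ne (compact_setX c1 c2) (continuous_subspaceT cont).
rewrite inE => -[/= K1x K2y] mxy; exists `|x - y|.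
  by rewrite normr_gt0 subr_eq0; apply/eqP => xy; apply: (disj x K1x); rewrite xy.
by move=> u v K1u K2v; apply: (mxy (u, v)); rewrite inE.
Qed.

(** The difference of the distances to the images of two opposite faces is at most [- d]
    on one of them and at least [d] on the other, for some [d > 0] given by compactness.
    So a shift by a vector [c] of norm at most [d / 2] outside the null set [u @` (f @` Q)]
    keeps the signs required by Poincare-Miranda, although [H - c] has no zero, and by
    compactness no approximate zeros. *)
Lemma injective_lipschitz_image_not_null (R : realType) k n (f : 'rV[R]_k -> 'rV[R]_n)
    (x0 : 'rV[R]_k) (sigma L : R) : (0 < k)%N -> 0 < sigma -> 0 <= L ->
  let Q := [set x : 'rV[R]_k | `|x - x0| <= sigma] in
  (forall x y, Q x -> Q y -> `|f x - f y| <= L * `|x - y|) ->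
  (forall x y, Q x -> Q y -> f x = f y -> x = y) ->
  ~ null_cover (@supdist R n) k (f @` Q).
Proof.
move=> k0 s0 L0 Q fL finj fnull.
have fcont : {within Q, continuous f} by exact: lipschitz_within_continuous fL.
pose face (e : R) (i : 'I_k) := Q `&` [set x | x 0 i = x0 0 i + e].
have coord_cont (i : 'I_k) : continuous (fun x : 'rV[R]_k => x 0 i) by exact: coord_continuous.
have face_closed e i : closed [set x : 'rV[R]_k | x 0 i = x0 0 i + e].
  apply: (@closed_comp _ _ (fun x : 'rV[R]_k => x 0 i) [set r | r = x0 0 i + e]).
    by move=> x _; exact: coord_cont.
  exact: closed_eq.
have cQ : compact Q by exact: closed_ball_compact.
have face_compact e i : compact (f @` face e i).
  apply: continuous_compact; first by apply: continuous_subspaceW fcont => x [].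
  by apply: compact_closedI => //; exact: face_closed.
have face_ne e i : `|e| <= sigma -> f @` face e i !=set0.
  move=> es; pose x := x0 + e *: basis_vec R k i.
  exists (f x), x => //; split; last by rewrite /= !mxE eqxx mulr1.
  rewrite /Q /= /x addrC addKr normrZ (le_trans _ es) // ler_piMr //.
  exact: norm_basis.
have ns0 : `|- sigma| <= sigma by rewrite normrN gtr0_norm.
have ps0 : `|sigma| <= sigma by rewrite gtr0_norm.
have /choice[del delP] (i : 'I_k) : exists d : R, 0 < d /\
    forall x y, (f @` face (- sigma) i) x -> (f @` face sigma i) y -> d <= `|x - y|.
  have [|d d0 dP] := @compact_sets_separated R n _ _ (face_compact (- sigma) i) (face_compact sigma i)
    (face_ne _ i ns0) (face_ne _ i ps0).
    move=> z [x [Qx xi] <-] [y [Qy yi] fyx].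
    have xy := finj _ _ Qx Qy (esym fyx); move: xi yi; rewrite xy /= => -> /addrI.
    by move/eqP; rewrite eqNr gt_eqF.
  by exists d.
pose d := \big[Num.min/1]_(i < k) del i.
have d0 : 0 < d by apply: (big_ind (fun x : R => 0 < x)) => // [x y x0' y0|i _]; [rewrite lt_min x0'|case: (delP i)].
have dle i : d <= del i by exact: bigmin_le_cond.
pose u (z : 'rV[R]_n) : 'rV[R]_k :=
  \row_i (setdist (f @` face (- sigma) i) z - setdist (f @` face sigma i) z).
have uL z z' : `|u z - u z'| <= 2 * `|z - z'|.
  apply: norm_le_coord => [|i]; first by rewrite mulr_ge0.
  rewrite !mxE opprD addrACA; apply: (le_trans (ler_normD _ _)).
  have := setdist_lipschitz (face_ne _ i ns0) z z'.
  have := setdist_lipschitz (face_ne _ i ps0) z z'.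
  by rewrite -[X in _ + X <= _]normrN opprD !opprK; lra.
have unull : null_cover (@supdist R k) k (u @` (f @` Q)).
  apply: (@null_cover_image _ _ _ (@supdist R n) _ _ _ _ 1 2) => // x y _ _ _.
  by rewrite /supdist -EFinM lee_fin.
have d2 : 0 < d / 2 by rewrite divr_gt0.
have d2d : d / 2 < d by rewrite ltr_pdivrMr // ltr_pMr // ltr1n.
have [c cd nc] := null_cover_avoid k0 d2 unull.
have cdi i : - (d / 2) <= c 0 i <= d / 2.
  by rewrite -ler_norml (le_trans (coord_le_norm _ _)).
pose H x := u (f x).
have HL x y : Q x -> Q y -> `|H x - H y| <= (2 * L) * `|x - y|.
  move=> Qx Qy; apply: (le_trans (uL _ _)).
  by rewrite -mulrA ler_wpM2l // fL.
have HcL x y : Q x -> Q y -> `| `|H x - c| - `|H y - c| | <= (2 * L) * `|x - y|.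
  move=> Qx Qy; apply: le_trans (HL x y Qx Qy); apply: (le_trans (ler_dist_dist _ _)).
  by rewrite opprB addrA subrK.
have L2 : 0 <= 2 * L by rewrite mulr_ge0.
have Hcont : {within Q, continuous (fun x => `|H x - c|)}.
  exact: (@lipschitz_within_continuous R _ R^o _ _ _ L2 HcL).
have Qne : Q !=set0 by exists x0; rewrite /Q /= subrr normr0 ltW.
(* the minimum of [`|H - c|] is positive, whereas Poincare-Miranda makes it arbitrarily small *)
have [z zQ zmin] := EVT_min_rV Qne cQ Hcont.
rewrite inE in zQ.
have e0 : 0 < `|H z - c|.
  rewrite normr_gt0 subr_eq0; apply/eqP => Hzc; apply: nc; exists (f z); last exact: Hzc.
  by exists z.
have e2 : 0 < `|H z - c| / 2 by rewrite divr_gt0.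
have at_face e i x : `|e| <= sigma -> Q x -> x 0 i = x0 0 i + e ->
    setdist (f @` face e i) (f x) <= 0.
  move=> es Qx xi; have Fx : (f @` face e i) (f x) by apply: imageP.
  by apply: (le_trans (setdist_le (face_ne e i es) _ Fx)); rewrite subrr normr0.
have Hm i x : Q x -> x 0 i = x0 0 i - sigma -> H x 0 i <= c 0 i.
  move=> Qx xi; have h1 := at_face (- sigma) i x ns0 Qx xi.
  have h2 : d <= setdist (f @` face sigma i) (f x).
    apply: le_setdist; first exact: face_ne.
    move=> y Fy; apply: (le_trans (dle i)); have [_ h] := delP i; apply: h => //.
    by apply: imageP.
  rewrite mxE; apply: (le_trans (lerB h1 h2)); rewrite sub0r.
  have /andP[cd1 _] := cdi i; apply: le_trans cd1; rewrite lerN2; exact: ltW.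
have Hp i x : Q x -> x 0 i = x0 0 i + sigma -> c 0 i < H x 0 i.
  move=> Qx xi; have h1 := at_face sigma i x ps0 Qx xi.
  have h2 : d <= setdist (f @` face (- sigma) i) (f x).
    apply: le_setdist; first exact: face_ne.
    move=> y Fy; rewrite distrC; apply: (le_trans (dle i)); have [_ h] := delP i; apply: h => //.
    by apply: imageP.
  rewrite mxE; apply: lt_le_trans (lerB h2 h1); rewrite subr0.
  have /andP[_ cd2] := cdi i; exact: le_lt_trans cd2 d2d.
have [x Qx xe] := miranda_approx s0 L2 HL Hm Hp e2.
have := le_trans (zmin x (mem_set Qx)) xe; move: (`|H z - c|) e0 => r r0.
by rewrite leNgt ltr_pdivrMr // ltr_pMr // ltr1n.
Qed.

(** * The theorem *)

(** The passage from the Euclidean norm to the sup norm, which defines the topology,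
    costs a dimensional factor. *)
Lemma locally_lipschitz_ball (R : realType) k n (Omega : set 'rV[R]_k)
    (f : 'rV[R]_k -> 'rV[R]_n) x0 :
  open Omega -> locally_lipschitz Omega f -> Omega x0 ->
  exists2 rho, 0 < rho & exists2 L, 0 <= L & forall x, `|x - x0| < rho ->
    Omega x /\ forall y, `|y - x0| < rho -> `|f x - f y| <= L * `|x - y|.
Proof.
move=> Oo fL Ox0; have [U nU [L L0 LP]] := fL x0 Ox0.
have : nbhs x0 (Omega `&` U) by apply: filterI => //; exact: open_nbhs_nbhs.
move=> /nbhs_ballP[rho /= rho0 rhoP]; exists rho => //.
exists (L * k%:R) => [|x xr]; first by rewrite mulr_ge0.
have inU y : `|y - x0| < rho -> (Omega `&` U) y.
  by move=> yr; apply: rhoP; rewrite -ball_normE /= distrC.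
split=> [|y yr]; first by case: (inU x xr).
have := LP x y (inU x xr) (inU y yr); rewrite /euclid_dist -EFinM lee_fin => h.
apply: (le_trans (norm_le_enorm _)); apply: (le_trans h).
by rewrite -mulrA ler_wpM2l // enorm_le_norm.
Qed.

Theorem proposition1p7 (R : realType) (k : nat) (k_gt0 : (0 < k)%N)
    (Omega : set 'rV[R]_k) (Omega_open : open Omega) (Omega_neq0 : Omega !=set0)
    (n : nat) (G : carnot_group R n) (G_unrect : purely_unrectifiable G k) :
  ~ exists f : 'rV[R]_k -> 'rV[R]_n,
      [/\ {in Omega &, injective f}, weakly_contact G Omega f
        & locally_lipschitz Omega f].
Proof.
move=> [f [finj fcontact floc]]; have [x0 Ox0] := Omega_neq0.
have [rho rho0 [L L0 fL]] := locally_lipschitz_ball Omega_open floc Ox0.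
pose N := [set x | Omega x /\
  ~ (differentiable f x /\ range ('d f x) `<=` horizontal_space G (f x))].
have Nnull : null_cover (@supdist R k) k N.
  apply: (@null_cover_dist R _ (@euclid_dist R k) _ _ _ 1 1) => //.
    by move=> x y _ _ _; rewrite mul1e lee_fin norm_le_enorm.
  exact: hausdorff_null_cover.
have fN x : `|x - x0| < rho -> ~ N x ->
    differentiable f x /\ range ('d f x) `<=` horizontal_space G (f x).
  by move=> /fL[Ox _] nN; apply: contrapT => h; apply: nN.
have fL' x y : `|x - x0| < rho -> `|y - x0| < rho -> `|f x - f y| <= L * `|x - y|.
  by move=> /fL[_ h] /h.
have [C C0 fdcc] := dcc_lipschitz k_gt0 rho0 L0 fL' Nnull fN.
pose Q := [set x : 'rV[R]_k | `|x - x0| <= rho / 8].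
have rho8 : 0 < rho / 8 by rewrite divr_gt0.
have Qrho x : Q x -> `|x - x0| < rho by rewrite /Q /= => /le_lt_trans; apply; lra.
have fQnull : null_cover (dcc G) k (f @` Q).
  apply/hausdorff_null_cover/G_unrect; exists C => // x y Qx Qy.
  apply: (le_trans (fdcc x y Qx Qy)).
  by rewrite /euclid_dist -EFinM lee_fin ler_wpM2l // norm_le_enorm.
(* [B] bounds [f] on [Q], so that local domination applies at all points of the image *)
pose B := `|f x0| + L * rho.
have [e e0 [D D0 dccD]] := dcc_locally_dominates G B.
apply: (@injective_lipschitz_image_not_null R k n f x0 (rho / 8) L) => //.
- by move=> x y /Qrho xr /Qrho yr; exact: fL'.
- move=> x y /Qrho/fL[Ox _] /Qrho/fL[Oy _]; apply: finj; exact: mem_set.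
apply: (null_cover_dist k_gt0 e0 D0 _ fQnull) => _ q [x Qx <-] _ lt.
apply: dccD => //; rewrite -(subrK (f x0) (f x)) addrC (le_trans (ler_normD _ _)) // lerD2l.
have x00 : `|x0 - x0| < rho by rewrite subrr normr0.
by apply: (le_trans (fL' x x0 (Qrho x Qx) x00)); rewrite ler_wpM2l // ltW // Qrho.
Qed.
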